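(* Let $S$ be a complex projective K3 surface of degree $2d$ with N\'eron--Severi group $\mathrm{NS}(S) = \mathbb{Z}h \cong \mathbb{Z}$ ($h^2=2d>0$), and let $T_S := \langle h\rangle^\perp \subset \mathrm{H}^2(S,\mathbb{Z})$ be its transcendental lattice. Let $p$ be an odd prime. Consider the sublattices $\Gamma_{\langle\alpha\rangle}\subset T_S$ of index $p$ associated to nontrivial $\alpha\in \mathrm{Br}(S)[p]$, with their invariants $i_\alpha\in\{0,1\}$ and $c_\alpha$; write $d(\Gamma_{\langle\alpha\rangle})$ for the discriminant group and $q\colon d(\Gamma_{\langle\alpha\rangle}) \to \mathbb{Q}/2\mathbb{Z}$ for the discriminant form of $\Gamma_{\langle\alpha\rangle}$. 1. If $p \nmid d$, then there are exactly three isomorphism classes of lattices $\Gamma_{\langle\alpha\rangle}$. They are: (a) those with $d(\Gamma_{\langle\alpha\rangle})\cong \mathbb{Z}/2dp^2\mathbb{Z}$, generated by an element $v$ such that $-2dp^2q(v)$ is a square modulo $p$; there are $\frac{1}{2}p^{10}(p^{10}+1)$ such sublattices $\Gamma_{\langle\alpha\rangle}$ of $T_S$; (b) those with $d(\Gamma_{\langle\alpha\rangle})\cong \mathbb{Z}/2dp^2\mathbb{Z}$, generated by an element $v$ such that $-2dp^2q(v)$ is not a square modulo $p$; there are $\frac{1}{2}p^{10}(p^{10}-1)$ such sublattices; (c) those with $d(\Gamma_{\langle\alpha\rangle})\cong \mathbb{Z}/2d\mathbb{Z}\oplus\mathbb{Z}/p\mathbb{Z}\oplus\mathbb{Z}/p\mathbb{Z}$;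 there are $\frac{p^{20}-1}{p-1}$ such sublattices. 2. If $p\mid d$, then there are exactly four isomorphism classes of lattices $\Gamma_{\langle\alpha\rangle}$. They are: (a) those with $i_\alpha=0$ and $c_\alpha$ a (nonzero) quadratic residue modulo $p$, for which $d(\Gamma_{\langle\alpha\rangle})\cong \mathbb{Z}/2d\mathbb{Z}\oplus\mathbb{Z}/p^2\mathbb{Z}$; there are $\frac{1}{2}p^{9}(p^{10}-1)$ such sublattices; (b) those with $i_\alpha=0$ and $c_\alpha$ a quadratic nonresidue modulo $p$, for which $d(\Gamma_{\langle\alpha\rangle})\cong \mathbb{Z}/2d\mathbb{Z}\oplus\mathbb{Z}/p^2\mathbb{Z}$; there are $\frac{1}{2}p^{9}(p^{10}-1)$ such sublattices; (c) those with $i_\alpha=0$ and $c_\alpha\equiv 0 \bmod p$, for which $d(\Gamma_{\langle\alpha\rangle})\cong \mathbb{Z}/2d\mathbb{Z}\oplus\mathbb{Z}/p\mathbb{Z}\oplus\mathbb{Z}/p\mathbb{Z}$; there are $\frac{(p^9+1)(p^{10}-1)}{p-1}$ such sublattices; (d) those with $i_\alpha=1$ (no restriction on $c_\alpha$), for which $d(\Gamma_{\langle\alpha\rangle})\cong\mathbb{Z}/2dp^2\mathbb{Z}$; there are $p^{20}$ such sublattices.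
   Context: A lattice is a free $\mathbb{Z}$-module $\Gamma$ of finite rank with a nondegenerate integral symmetric bilinear form $(\cdot,\cdot)$; it is even if $(\gamma,\gamma)\in 2\mathbb{Z}$ for all $\gamma$. Isomorphism of lattices means isometry. The discriminant group is $d(\Gamma)=\Gamma^*/\Gamma$ with $\Gamma^*=\mathrm{Hom}(\Gamma,\mathbb{Z})$, where $\Gamma\subseteq\Gamma^*$ via the form; for $\Gamma$ even, the discriminant form is $q\colon d(\Gamma)\to\mathbb{Q}/2\mathbb{Z}$, $x+\Gamma\mapsto (x,x) \bmod 2\mathbb{Z}$, using the $\mathbb{Q}$-bilinear extension of $(\cdot,\cdot)$ to $\Gamma^*$. $\mathrm{H}^2(S,\mathbb{Z})$ is a lattice under the intersection form, and $T_S\cong \mathbb{Z}v_0\oplus\Lambda'$ with $v_0^2=-2d$ and $\Lambda'=U\oplus U\oplus E_8(-1)^2$, where $U$ is the hyperbolic plane and $E_8(-1)$ the negative definite even unimodular lattice of rank 8; fix such an identification. A nontrivial $\alpha\in\mathrm{Br}(S)[p]$ corresponds to a surjective homomorphism $\alpha\colon T_S\to\mathbb{Z}/p\mathbb{Z}$, and its kernel $\Gamma_{\langle\alpha\rangle}$ is a sublattice of index $p$ depending only on the subgroup $\langle\alpha\rangle$; this gives a bijection between subgroups of order $p$ of $\mathrm{Br}(S)$ and sublattices of index $p$ of $T_S$. The homomorphism has the form $zv_0+\lambda'\mapsto z\,i_\alpha+\langle\lambda_\alpha,\lambda'\rangle \bmod p$ for some $i_\alpha \in\{0,\dots,p-1\}$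 and some $\lambda_\alpha\in\Lambda'$, whose class in $\Lambda'/p\Lambda'$ is well defined. Replacing $\alpha$ by a multiple (which does not change the kernel), one assumes $i_\alpha\in\{0,1\}$. The integer $c_\alpha$ is defined by $\lambda_\alpha^2=-2c_\alpha$; its class modulo $p$ is determined by $\alpha$ (when $i_\alpha=0$, changing the generator of $\langle\alpha\rangle$ multiplies $c_\alpha$ by a nonzero square modulo $p$). *)

(* Defs.v *)
From HB Require Import structures.
From mathcomp Require Import all_boot all_order all_algebra.
From mathcomp Require Import ring_quotient.
From mathcomp Require Import complex ring.
From mathcomp Require Import all_classical all_reals.

Set Implicit Arguments.
Unset Strict Implicit.
Unset Printing Implicit Defensive.

Import Order.TTheory GRing.Theory Num.Theory.
Local Open Scope ring_scope.
Local Open Scope classical_set_scope.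

(* ---------------------------------------------------------------------- *)
(* Z-modules with an integral symmetric bilinear form.                    *)
(* All the instances below are lattices: H^2(S, Z) and the sums of U,     *)
(* E_8(-1) and Z v0 are so, and the sublattices used are subgroups of     *)
(* finite index of h^perp, where h^2 <> 0. Freeness, finite rank and      *)
(* nondegeneracy are consequences and are not carried along.              *)
(* ---------------------------------------------------------------------- *)

Record zlattice := Zlattice {
  lsort :> zmodType;
  lform : lsort -> lsort -> int;
  formC : forall x y, lform x y = lform y x;
  formDl : forall x y z, lform (x + y) z = lform x z + lform y z }.

Definition is_isometry (M N : zlattice) (f : {additive M -> N}) : Prop :=
  bijective f /\ forall x y, lform (f x) (f y) = lform x y.

Definition isometric (M N : zlattice) : Prop :=
  exists f : {additive M -> N}, is_isometry f.

Lemma formBl (M : zlattice) (x y z : M) :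
  lform (x - y) z = lform x z - lform y z.
Proof. by apply/eqP; rewrite eq_sym subr_eq -formDl subrK. Qed.

Lemma form0l (M : zlattice) (z : M) : lform 0 z = 0.
Proof. by rewrite -{1}(subrr (0 : M)) formBl subrr. Qed.

Section Subgroup.
Variable V : zmodType.

Record subgroup := Subgroup {
  sg_set : set V;
  sg0 : sg_set 0;
  sgB : forall x y, sg_set x -> sg_set y -> sg_set (x - y) }.

Variable G : subgroup.

Definition sg_pred : {pred V} := [pred x | `[< sg_set G x >]].

Lemma sg_zmod_closed : zmod_closed sg_pred.
Proof.
split=> [|x y]; first exact: asboolT (sg0 G).
by move=> /asboolP Gx /asboolP Gy; apply: asboolT; apply: sgB.
Qed.
HB.instance Definition _ := GRing.isZmodClosed.Build V sg_pred sg_zmod_closed.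

Definition sg_sort := {x : V | x \in sg_pred}.
HB.instance Definition _ := SubChoice.on sg_sort.
HB.instance Definition _ := [SubChoice_isSubZmodule of sg_sort by <:].

Definition sg_quot := Quotient.quot sg_pred.
HB.instance Definition _ := GRing.Zmodule.on sg_quot.
End Subgroup.

Section Sublattice.
Variables (M : zlattice) (G : subgroup M).

Definition sub_form (x y : sg_sort G) : int := lform (val x) (val y).

Lemma sub_formC x y : sub_form x y = sub_form y x.
Proof. exact: formC. Qed.

Lemma sub_formDl x y z : sub_form (x + y) z = sub_form x z + sub_form y z.
Proof. exact: formDl. Qed.

Definition sublattice : zlattice := Zlattice sub_formC sub_formDl.
End Sublattice.

Section Orthogonal.
Variables (M : zlattice) (h : M).

Definition orth_set : set M := [set x | lform x h = 0].

Lemma orth0 : orth_set 0.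
Proof. exact: form0l. Qed.

Lemma orthB x y : orth_set x -> orth_set y -> orth_set (x - y).
Proof. by rewrite /orth_set /= formBl => -> ->; rewrite subrr. Qed.

Definition orth : subgroup M := Subgroup orth0 orthB.
End Orthogonal.

Section Kernel.
Variables (U V : zmodType) (f : {additive U -> V}).

Definition ker_set : set U := [set x | f x = 0].

Lemma ker0 : ker_set 0.
Proof. exact: raddf0. Qed.

Lemma kerB x y : ker_set x -> ker_set y -> ker_set (x - y).
Proof. by rewrite /ker_set /= raddfB => -> ->; rewrite subrr. Qed.

Definition kernel : subgroup U := Subgroup ker0 kerB.
End Kernel.

(* ---------------------------------------------------------------------- *)
(* Discriminant group and discriminant form                               *)
(* ---------------------------------------------------------------------- *)

Section Discriminant.
Variable M : zlattice.

Definition hom_set : set (M -> int) := [set f | zmod_morphism f].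

Lemma hom0 : hom_set 0.
Proof. by move=> x y; rewrite subrr. Qed.

Lemma homB f g : hom_set f -> hom_set g -> hom_set (f - g).
Proof.
move=> fM gM x y; rewrite (_ : (f - g) (x - y) = f (x - y) - g (x - y))//.
by rewrite fM gM !opprD !opprK addrACA.
Qed.

(* M^* = Hom(M, Z) *)
Definition dual_group := sg_sort (Subgroup hom0 homB).

(* the image of M in M^* under x |-> (x, .) *)
Definition embed_set : set dual_group :=
  [set f | exists x : M, forall y, val f y = lform x y].

Lemma embed0 : embed_set 0.
Proof. by exists 0 => y; rewrite form0l. Qed.

Lemma embedB f g : embed_set f -> embed_set g -> embed_set (f - g).
Proof. by move=> [a fa] [b gb]; exists (a - b) => y; rewrite formBl -fa -gb. Qed.

(* d(M) = M^* / M *)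
Definition discr := sg_quot (Subgroup embed0 embedB).

(* The Q-bilinear extension of the form to M^*, which sits in M (x) Q: if *)
(* n f = (x, .) with n != 0, that is, f = x / n, then (f, g) = g(x) / n.  *)
Definition is_fraction (f : dual_group) : set (int * M) :=
  [set nx | nx.1 != 0 /\ forall y, nx.1 * val f y = lform nx.2 y].

Definition dual_form (f g : dual_group) : rat :=
  let nx := xget (1, 0) (is_fraction f) in (val g nx.2)%:~R / nx.1%:~R.

Lemma dual_formE (f g : dual_group) (n m : int) (x y : M) :
  is_fraction f (n, x) -> is_fraction g (m, y) ->
  dual_form f g = (lform x y)%:~R / (n%:~R * m%:~R).
Proof.
move=> fx gy; rewrite /dual_form.
have := @xgetPex _ (1, 0) (is_fraction f) (ex_intro _ _ fx).
move: fx gy; case: xget => [n' x'] /= [n0 fx] [m0 gy] [n'0 fx'].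
have n0q : n%:~R != 0 :> rat by rewrite intr_eq0.
have m0q : m%:~R != 0 :> rat by rewrite intr_eq0.
have n'0q : n'%:~R != 0 :> rat by rewrite intr_eq0.
apply/eqP; rewrite eqr_div ?mulf_neq0// -!intrM eqr_int; apply/eqP.
rewrite [n * m]mulrC mulrA [_ * m]mulrC gy mulrC formC -fx'.
by rewrite mulrCA fx mulrC.
Qed.
End Discriminant.

Definition even_int_set : set rat := [set r | exists k : int, r = (2 * k)%:~R].

Lemma even_int0 : even_int_set 0.
Proof. by exists 0. Qed.

Lemma even_intB r s :
  even_int_set r -> even_int_set s -> even_int_set (r - s).
Proof. by move=> [k ->] [l ->]; exists (k - l); rewrite mulrBr intrB. Qed.

Definition Qmod2Z := sg_quot (Subgroup even_int0 even_intB).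

Local Open Scope quotient_scope.

Definition mod2Z (r : rat) : Qmod2Z := \pi r.

(* q; independent of the representative when M is an even lattice *)
Definition discr_form (M : zlattice) (x : discr M) : Qmod2Z :=
  mod2Z (dual_form (repr x) (repr x)).

Lemma discr_formE (M : zlattice) (f : dual_group M) (nx : int * M) :
  (forall x : M, exists k : int, lform x x = 2 * k) -> is_fraction f nx ->
  discr_form (\pi f : discr M) = mod2Z (dual_form f f).
Proof.
case: nx => n x evM fnx; rewrite /discr_form.
set g := repr _.
have : embed_set (g - f).
  suff: (g - f) \in sg_pred (Subgroup (@embed0 M) (@embedB M)) by move=> /asboolP.
  by rewrite Quotient.idealrBE reprK.
move=> [a ga].
have gy y : val g y = val f y + lform a y.
  by rewrite -ga (_ : val (g - f) y = val g y - val f y)// addrC subrK.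
have [/= n0 fxy] := fnx.
have formMz (b y : M) : lform (b *~ n) y = n * lform b y.
  pose F := GRing.isZmodMorphism.Build M int (fun b : M => lform b y)
    (fun b c => formBl b c y).
  pose G : {additive M -> int} := HB.pack (fun b : M => lform b y) F.
  by rewrite -[LHS]/(G _) raddfMz -mulrzl intz.
have gnx : is_fraction g (n, x + a *~ n).
  by split=> //= y; rewrite gy mulrDr fxy formDl formMz.
rewrite (dual_formE gnx gnx) (dual_formE fnx fnx).
have [k ak] := evM a.
have n0q : n%:~R != 0 :> rat by rewrite intr_eq0.
have -> : lform (x + a *~ n) (x + a *~ n) =
    lform x x + (2 * (val f a + k)) * (n * n).
  rewrite !formDl ![lform _ (_ + _)]formC !formDl !formMz.
  rewrite ![lform _ (_ *~ _)]formC !formMz ak [lform a x]formC -(fxy a) /=.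
  by ring.
rewrite intrD mulrDl -[(n%:~R * n%:~R)]intrM [(_ * (n * n))%:~R]intrM.
rewrite mulfK ?intr_eq0 ?mulf_neq0//.
apply/eqP; rewrite /mod2Z -Quotient.idealrBE addrAC subrr add0r.
by apply: asboolT; exists (val f a + k).
Qed.

(* The integer k represents N q(v): k = N r for a rational lift r of q(v). *)
(* Thus k is determined modulo 2N.                                         *)
Definition represents (M : zlattice) (N : int) (v : discr M) (k : int) : Prop :=
  exists r : rat, mod2Z r = discr_form v /\ N%:~R * r = k%:~R.

Definition generates (A : zmodType) (v : A) : Prop :=
  forall w : A, exists k : int, w = v *~ k.

Definition group_iso (A B : zmodType) : Prop :=
  exists f : {additive A -> B}, bijective f.

Definition square_mod (p : nat) (k : int) : Prop :=
  exists m : int, (k = m ^+ 2 %[mod p%:Z])%Z.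

(* ---------------------------------------------------------------------- *)
(* Explicit lattices                                                      *)
(* ---------------------------------------------------------------------- *)

Section Gram.
Variables (n : nat) (A : 'M[int]_n) (symA : A^T = A).

Definition gram_form (x y : 'rV[int]_n) : int := (x *m A *m y^T) 0 0.

Lemma gram_formC x y : gram_form x y = gram_form y x.
Proof.
have -> : gram_form y x = (x *m A *m y^T)^T 0 0; last by rewrite mxE.
by rewrite !trmx_mul trmxK symA mulmxA.
Qed.

Lemma gram_formDl x y z : gram_form (x + y) z = gram_form x z + gram_form y z.
Proof. by rewrite /gram_form !mulmxDl mxE. Qed.

Definition gram_lattice : zlattice := Zlattice gram_formC gram_formDl.
End Gram.

Definition dsum (m n : nat) (A : 'M[int]_m) (B : 'M[int]_n) : 'M[int]_(m + n) :=
  block_mx A 0 0 B.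

Lemma dsum_sym m n (A : 'M[int]_m) (B : 'M[int]_n) :
  A^T = A -> B^T = B -> (dsum A B)^T = dsum A B.
Proof. by move=> sA sB; rewrite /dsum tr_block_mx sA sB !trmx0. Qed.

Definition U_mx : 'M[int]_2 := \matrix_(i, j) (i != j)%:R.

(* Dynkin diagram: the chain 0 - 1 - 2 - 3 - 4 - 5 - 6, with 7 joined to 2 *)
Definition E8_edge (i j : nat) : bool :=
  (((i.+1 == j) && (j < 7)) || ((i == 2) && (j == 7)))%N.

Definition E8neg_mx : 'M[int]_8 :=
  \matrix_(i, j) (if i == j then - 2
                  else if E8_edge i j || E8_edge j i then 1 else 0).

Definition Lambda'_mx := dsum U_mx (dsum U_mx (dsum E8neg_mx E8neg_mx)).
Definition K3_mx := dsum U_mx Lambda'_mx.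
Definition v0Lambda'_mx (d : nat) := dsum ((- (2 * d%:Z))%:M : 'M_1) Lambda'_mx.

Lemma Lambda'_sym : Lambda'_mx^T = Lambda'_mx.
Proof.
have sU : U_mx^T = U_mx by apply/matrixP => i j; rewrite !mxE eq_sym.
have sE : E8neg_mx^T = E8neg_mx.
  by apply/matrixP => i j; rewrite !mxE eq_sym orbC.
by rewrite !dsum_sym.
Qed.

Lemma K3_sym : K3_mx^T = K3_mx.
Proof.
apply: dsum_sym Lambda'_sym.
by apply/matrixP => i j; rewrite !mxE eq_sym.
Qed.

Lemma v0Lambda'_sym d : (v0Lambda'_mx d)^T = v0Lambda'_mx d.
Proof. by apply: dsum_sym Lambda'_sym; rewrite tr_scalar_mx. Qed.

Definition Lambda' : zlattice := gram_lattice Lambda'_sym.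

(* Z v0 (+) Lambda' with v0^2 = - 2 d; z v0 + l is row_mx z%:M l *)
Definition v0Lambda' (d : nat) : zlattice := gram_lattice (v0Lambda'_sym d).

Definition v0_add (d : nat) (z : int) (l : Lambda') : v0Lambda' d :=
  row_mx (z%:M : 'M_1) (l : 'rV[int]_(2 + (2 + (8 + 8)))).

(* ---------------------------------------------------------------------- *)
(* K3 surfaces                                                            *)
(* ---------------------------------------------------------------------- *)

(* H^2(S, Z) of a complex K3 surface S *)
Definition H2 : zlattice := gram_lattice K3_sym.

(* A complex K3 surface, together with a marking of H^2(S, Z), given by its *)
(* Hodge structure: the period spans H^{2,0}(S), in H^2(S, C). By the       *)
(* Torelli theorem and the surjectivity of the period map, these data are   *)
(* the same as a K3 surface up to isomorphism. Such an S is projective as   *)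
(* soon as NS(S) contains a class of positive square.                       *)
Record K3 (R : realType) := MarkedK3 {
  period : 'rV[R[i]]_(2 + (2 + (2 + (8 + 8))));
  period_sq0 : period *m map_mx intr K3_mx *m period^T = 0;
  period_gt0 :
    0 < (period *m map_mx intr K3_mx *m (map_mx Num.conj period)^T) 0 0 }.

(* Lefschetz (1,1): the integral classes orthogonal to H^{2,0} *)
Definition NS (R : realType) (S : K3 R) : set H2 :=
  [set x | map_mx intr x *m map_mx intr K3_mx *m (period S)^T = 0].

Section Brauer.
Variables (h : H2) (p : nat).

Definition T_S : zlattice := sublattice (orth h).

(* Br(S)[p] = Hom(T_S, Z/p), p being prime *)
Definition Br : Type := {additive T_S -> 'F_p}.

(* the sublattices Gamma_<alpha> of T_S, for alpha nontrivial in Br(S)[p] *)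
Definition Gammas : set (subgroup T_S) :=
  [set G | exists2 alpha : Br,
     (forall a : 'F_p, exists x : T_S, alpha x = a) & G = kernel alpha].

(* G = Gamma_<alpha> for an alpha with i_alpha = i and lambda_alpha^2 = - 2 c *)
Definition has_invariants (d : nat) (phi : {additive v0Lambda' d -> T_S})
    (G : subgroup T_S) (i : nat) (c : int) : Prop :=
  exists (alpha : Br) (l : Lambda'),
    [/\ forall a : 'F_p, exists x : T_S, alpha x = a,
        G = kernel alpha,
        forall (z : int) (l' : Lambda'),
          alpha (phi (v0_add d z l')) = (z * i%:Z + lform l l')%:~R
      & lform l l = - (2 * c)].
End Brauer.

Definition isometry_class (M : zlattice) (X : set (subgroup M))
    (G : subgroup M) : set (subgroup M) :=
  [set G' | X G' /\ isometric (sublattice G) (sublattice G')].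

Definition isometry_classes (M : zlattice) (X : set (subgroup M)) :
  set (set (subgroup M)) := [set isometry_class X G | G in X].

(* Main.v *)
Require Import Defs.
From HB Require Import structures.
From mathcomp Require Import all_boot all_order all_algebra.
From mathcomp Require Import ring_quotient zify ring.
From mathcomp Require Import all_classical all_reals.

(** A nontrivial class of order [p] is a functional
      [z v0 + l |-> z i + (lambda, l)] modulo [p],
    and its kernel depends only on the line of [(i, lambda)]. The kernels are
    sorted by reducing these functionals to normal forms, telling the normal
    forms apart, and counting the functionals of each kind.

    Normal forms. Since [Lambda' = U (+) U (+) E_8(-1)^2] has two hyperbolic
    planes, explicit integral isometries, the Eichler maps, act on its vectors
    modulo [p] as transitively as the norm permits: a vector that is nonzero
    modulo [p] is moved to [t e + f] modulo [p], where [e, f] is the standard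
    basis of the first plane and [2 t] is the norm ([orbit_normal_form]).
    When [p] does not divide [d], every functional is the product with a vector
    of [Z v0 (+) Lambda'] modulo [p]; when [i = 0], with a vector of [Lambda'].
    In both cases the kernel is isometric to [split_lattice], that is, to
      [ [[- 2 t, p], [p, 0]] (+) U (+) <- 2 d> (+) E_8(-1)^2 ],
    where [t] is determined by [i^2 - 2 d lambda^2], respectively [lambda^2],
    modulo [p] and nonzero squares. When [p] divides [d] and [i = 1], the norm
    of [v0] vanishes modulo [p], and Eichler maps in the direction of [v0] clear
    [lambda] altogether: the kernel is [Z p v0 (+) Lambda'], isometric to
    [twisted_lattice] ([realizes_twisted]).

    Separating them. A functional on a normal form is determined, modulo those
    coming from the lattice, by its values on three basis vectors; this yields
    the discriminant groups. If [p] does not divide [d], then for [t] prime to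
    [p] the group is cyclic with a generator of value [- (p^2 - 4 d t) / 2 d p^2],
    and another generator multiplies this by the square of a unit modulo [p];
    for [t = 0] it has exponent [2 d p], so it is not cyclic. If [p] divides [d],
    then the form of [split_lattice] modulo [p] comes from a form of rank 19 and
    determinant [- 2 t] up to a constant, so that [t] modulo squares is an
    invariant ([split_isometric_square]), while [twisted_lattice] is singled out
    by the exponent of its discriminant group.

    Counting. Modulo [p] the form of [E_8] is a multiple of a sum of eight
    squares, and [- 1] is a sum of two squares; hence [Lambda'] becomes a sum of
    ten hyperbolic planes ([gram_quad_Lambda']), and the functionals with a given
    invariant are easily counted. Each line contains two functionals with
    a prescribed nonzero invariant, [p - 1] isotropic ones, and one with
    [i = 1]. *)

Set Implicit Arguments.
Unset Strict Implicit.
Unset Printing Implicit Defensive.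

Import Order.TTheory GRing.Theory Num.Theory.
Local Open Scope ring_scope.
Local Open Scope classical_set_scope.
Local Open Scope card_scope.

(** * Lattices, orthogonal sums and isometries *)

#[global] Arguments lform : simpl never.

Section FormTheory.
Variable M : zlattice.
Implicit Types x y z : M.

Lemma lformC x y : lform x y = lform y x.
Proof. exact: Defs.formC. Qed.

Lemma lformDl x y z : lform (x + y) z = lform x z + lform y z.
Proof. exact: Defs.formDl. Qed.

Lemma lformBl x y z : lform (x - y) z = lform x z - lform y z.
Proof. exact: Defs.formBl. Qed.

Lemma lform0l x : lform 0 x = 0.
Proof. exact: Defs.form0l. Qed.

Lemma lformDr x y z : lform x (y + z) = lform x y + lform x z.
Proof. by rewrite lformC lformDl !(lformC x). Qed.

Lemma lform0r x : lform x 0 = 0.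
Proof. by rewrite lformC lform0l. Qed.

Lemma lformNl x y : lform (- x) y = - lform x y.
Proof. by rewrite -[- x]add0r lformBl lform0l add0r. Qed.

Lemma lformNr x y : lform x (- y) = - lform x y.
Proof. by rewrite lformC lformNl lformC. Qed.

Lemma lformMnl x y n : lform (x *+ n) y = n%:Z * lform x y.
Proof.
elim: n => [|n IH]; first by rewrite mulr0n lform0l mul0r.
by rewrite mulrS lformDl IH -[n.+1]addn1 PoszD; ring.
Qed.

Lemma lformMzl x y (n : int) : lform (x *~ n) y = n * lform x y.
Proof.
by case: n => n; rewrite /intmul ?lformNl lformMnl // NegzE mulNr.
Qed.

Lemma lformMzr x y (n : int) : lform x (y *~ n) = n * lform x y.
Proof. by rewrite lformC lformMzl lformC. Qed.
End FormTheory.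

Definition even_lattice (M : zlattice) : Prop :=
  forall x : M, exists k : int, lform x x = 2 * k.

Section OrthogonalSum.
Variables M N : zlattice.

Definition osum_form (x y : M * N) : int := lform x.1 y.1 + lform x.2 y.2.

Lemma osum_formC x y : osum_form x y = osum_form y x.
Proof. by rewrite /osum_form lformC (lformC x.2). Qed.

Lemma osum_formDl x y z : osum_form (x + y) z = osum_form x z + osum_form y z.
Proof. by rewrite /osum_form !lformDl addrACA. Qed.

Definition osum : zlattice := Zlattice osum_formC osum_formDl.

Lemma osum_even : even_lattice M -> even_lattice N -> even_lattice osum.
Proof.
move=> evM evN [x y]; have [k kx] := evM x; have [l ly] := evN y.
by exists (k + l); rewrite mulrDr -kx -ly.
Qed.
End OrthogonalSum.

Section SmallLattices.

Definition form1 (n : int) (x y : int) : int := n * (x * y).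

Lemma form1C n x y : form1 n x y = form1 n y x.
Proof. by rewrite /form1 [y * x]mulrC. Qed.

Lemma form1Dl n x y z : form1 n (x + y) z = form1 n x z + form1 n y z.
Proof. by rewrite /form1 mulrDl mulrDr. Qed.

Definition lattice1 (n : int) : zlattice := Zlattice (form1C n) (form1Dl n).

(** The form with Gram matrix [[a, b], [b, 0]]. *)
Definition form2 (a b : int) (x y : int * int) : int :=
  a * (x.1 * y.1) + b * (x.1 * y.2 + x.2 * y.1).

Lemma form2C a b x y : form2 a b x y = form2 a b y x.
Proof. by rewrite /form2; ring. Qed.

Lemma form2Dl a b x y z :
  form2 a b (x + y) z = form2 a b x z + form2 a b y z.
Proof. by rewrite /form2 /=; ring. Qed.

Definition lattice2 (a b : int) : zlattice :=
  Zlattice (form2C a b) (form2Dl a b).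

Definition hplane : zlattice := lattice2 0 1.

Lemma lattice1_even n : even_lattice (lattice1 (2 * n)).
Proof. by move=> x; exists (n * (x * x)); rewrite mulrA. Qed.

Lemma lattice2_even a b : even_lattice (lattice2 (2 * a) b).
Proof.
move=> [x y]; exists (a * (x * x) + b * (x * y)).
by rewrite /lform /= /form2 /=; ring.
Qed.

Lemma hplane_even : even_lattice hplane.
Proof. by have := @lattice2_even 0 1; rewrite mulr0. Qed.
End SmallLattices.

Lemma osumE (M N : zlattice) (x y : osum M N) :
  lform x y = lform x.1 y.1 + lform x.2 y.2.
Proof. by []. Qed.

Lemma lattice1E n (x y : lattice1 n) : lform x y = n * (x * y).
Proof. by []. Qed.

Lemma lattice2E a b (x y : lattice2 a b) :
  lform x y = a * (x.1 * y.1) + b * (x.1 * y.2 + x.2 * y.1).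
Proof. by []. Qed.

Lemma hplaneE (x y : hplane) : lform x y = x.1 * y.2 + x.2 * y.1.
Proof. by rewrite lattice2E mul0r add0r mul1r. Qed.

Definition preserves_form (M N : zlattice) (f : M -> N) : Prop :=
  forall x y, lform (f x) (f y) = lform x y.

Definition isom (M N : zlattice) (f : M -> N) : Prop :=
  [/\ zmod_morphism f, bijective f & preserves_form f].

Lemma isom_isometric (M N : zlattice) (f : M -> N) : isom f -> isometric M N.
Proof.
move=> [fB fbij fform].
pose F : {additive M -> N} := HB.pack f (GRing.isZmodMorphism.Build M N f fB).
by exists F.
Qed.

Lemma isometric_isom (M N : zlattice) :
  isometric M N -> exists f : M -> N, isom f.
Proof. by move=> [f [bf pf]]; exists f; split=> //; apply: raddfB. Qed.

Lemma isom_id (M : zlattice) : isom (@id M).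
Proof. by split=> //; exists id. Qed.

Lemma isom_comp (M N P : zlattice) (g : N -> P) (f : M -> N) :
  isom g -> isom f -> isom (g \o f).
Proof.
move=> [gB gbij gform] [fB fbij fform]; split; last 1 first.
- by move=> x y /=; rewrite gform fform.
- by move=> x y /=; rewrite fB gB.
- exact: bij_comp.
Qed.

Lemma isom_inv (M N : zlattice) (f : M -> N) :
  isom f -> exists g : N -> M, [/\ isom g, cancel f g & cancel g f].
Proof.
move=> [fB [g fK gK] fform]; exists g; split=> //; split.
- by move=> x y; apply: (can_inj fK); rewrite fB !gK.
- by exists f.
- by move=> x y; rewrite -fform !gK.
Qed.

Lemma isometric_sym (M N : zlattice) : isometric M N -> isometric N M.
Proof.
by move=> /isometric_isom[f /isom_inv[g [gi _ _]]]; apply: isom_isometric gi.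
Qed.

Lemma isometric_trans (M N P : zlattice) :
  isometric M N -> isometric N P -> isometric M P.
Proof.
move=> /isometric_isom[f fi] /isometric_isom[g gi].
exact: isom_isometric (isom_comp gi fi).
Qed.

Lemma isom_osum (M M' N N' : zlattice) (f : M -> M') (g : N -> N') :
  isom f -> isom g ->
  isom (fun x : osum M N => (f x.1, g x.2) : osum M' N').
Proof.
move=> [fB [f' fK f'K] ff] [gB [g' gK g'K] gf]; split.
- by move=> [x y] [x' y'] /=; rewrite [LHS]/= fB gB.
- by exists (fun x => (f' x.1, g' x.2)) => [] [x y] /=; rewrite ?fK ?gK ?f'K ?g'K.
- by move=> [x y] [x' y']; rewrite /lform /= /osum_form /= ff gf.
Qed.

Lemma inj_surj_bij (A : Type) (B : Type) (f : A -> B) :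
  injective f -> (forall y, exists x, f x = y) -> bijective f.
Proof.
move=> fI fS; have /choice[g gK] := fS.
by exists g => // x; apply: fI; rewrite gK.
Qed.

(** A way to say that [N] is isometric to the sublattice [P] of [L] which passes
    through the isometries of [L] without any transport of subgroups. *)
Definition realizes (N L : zlattice) (P : L -> Prop) : Prop :=
  exists f : N -> L, [/\ zmod_morphism f, injective f, preserves_form f
    & forall x, P x <-> exists y, f y = x].

Lemma realizes_sublattice (N L : zlattice) (G : subgroup L) :
  realizes N (sg_set G) -> isometric N (sublattice G).
Proof.
move=> [f [fB fI ff fP]].
have fG y : f y \in sg_pred G by apply: asboolT; apply/fP; exists y.
pose g y : sublattice G := exist _ (f y) (fG y).
apply: (@isom_isometric _ _ g); split.
- by move=> x y; apply: val_inj; rewrite /= fB.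
- apply: inj_surj_bij => [x y /(congr1 val) /fI //|x].
  have /asboolP/fP[y fy] := valP x.
  by exists y; apply: val_inj.
- by move=> x y; apply: ff.
Qed.

Lemma realizes_isom (N L L' : zlattice) (g : L -> L') (P : L -> Prop)
    (P' : L' -> Prop) :
  isom g -> (forall x, P x <-> P' (g x)) -> realizes N P -> realizes N P'.
Proof.
move=> [gB gbij gg] PP' [f [fB fI ff fP]].
have [g' gK g'K] := gbij.
exists (g \o f); split.
- by move=> x y /=; rewrite fB gB.
- by move=> x y /(can_inj gK)/fI.
- by move=> x y /=; rewrite gg ff.
- move=> x; split.
  + rewrite -{1}[x]g'K => /PP'/fP[y fy]; exists y.
    by rewrite /= fy g'K.
  + by move=> [y <-]; apply/PP'/fP; exists y.
Qed.

(** * Eichler maps and their orbits modulo p *)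

Lemma pairMz (U V : zmodType) (x : U) (y : V) (n : int) :
  (x, y) *~ n = (x *~ n, y *~ n).
Proof.
have pairMn m : (x, y) *+ m = (x *+ m, y *+ m).
  by elim: m => // m IH; rewrite !mulrS IH.
by case: n => n; rewrite /intmul pairMn.
Qed.

Section Eichler.
Variables (K : zlattice).

(** With [e = (1, 0)] and [q = (a, a) / 2] this is the Eichler map
      [X |-> X + (X, e) a - (X, a) e - q (X, e) e],
    an isometry that fixes [e] and translates the component in [K] by a multiple
    of [a]. *)
Definition eichler (a : K) (q : int) (X : osum hplane K) : osum hplane K :=
  ((X.1.1 - lform X.2 a - q * X.1.2, X.1.2), X.2 + a *~ X.1.2).

Lemma eichlerK (a : K) (q : int) : lform a a = 2 * q ->
  cancel (eichler a q) (eichler (- a) q).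
Proof.
move=> aa [[x y] k]; rewrite /eichler /= mulNrz addrK; congr (_, _, _).
by rewrite lformNr lformDl lformMzl aa; ring.
Qed.

Lemma eichler_isom (a : K) (q : int) : lform a a = 2 * q ->
  isom (eichler a q).
Proof.
move=> aa; split.
- move=> [[x y] k] [[x' y'] k']; rewrite /eichler /=.
  congr (_, _, _); first by rewrite /= lformBl; ring.
  by rewrite /= mulrzBr addrACA -opprD.
- exists (eichler (- a) q); first exact: eichlerK.
  rewrite -{2}[a]opprK; apply: eichlerK.
  by rewrite lformNl lformNr opprK.
- move=> [[x y] k] [[x' y'] k'].
  rewrite !osumE !hplaneE /=.
  rewrite !(lformDl, lformDr, lformMzl, lformMzr) aa (lformC a k').
  by ring.
Qed.

Definition hswap (X : osum hplane K) : osum hplane K :=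
  ((X.1.2, X.1.1), X.2).

Lemma hswap_isom : isom hswap.
Proof.
split; first by [].
- by exists hswap => [] [[x y] k].
- move=> [[x y] k] [[x' y'] k'].
  by rewrite !osumE !hplaneE /=; ring.
Qed.
End Eichler.

Lemma exchange_isom (M N K : zlattice) :
  isom (fun X : osum M (osum N K) => (X.2.1, (X.1, X.2.2)) : osum N (osum M K)).
Proof.
split; first by [].
- by exists (fun X => (X.2.1, (X.1, X.2.2))) => [] [x [y k]].
- move=> [x [y k]] [x' [y' k']].
  by rewrite !osumE /= addrCA.
Qed.

Lemma prime_inv_int (p : nat) (y : int) : prime p -> ~~ (p %| y)%Z ->
  exists c w : int, c * y = 1 + w * p.
Proof.
move=> pp py; have [u [v uv]] := Bezoutz y p.
have g1 : gcdz y p = 1.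
  apply/eqP; rewrite gcdzC -[_ == _]/(coprimez p y) coprimezE prime_coprime //.
exists u, (- v); apply/eqP; rewrite mulNr -subr_eq opprK uv g1 //.
Qed.

Section Orbit.
Variables (p : nat) (K : zlattice).
Hypotheses (p_prime : prime p) (evK : even_lattice K).
Local Notation M := (osum hplane (osum hplane K)).

Definition normalizable (l : M) : Prop :=
  exists (g : M -> M) (t : int) (m : M),
    isom g /\ g l = ((t, 1), 0) + m *~ p.

Let normalizable_isom (l : M) (h : M -> M) :
  isom h -> normalizable (h l) -> normalizable l.
Proof.
move=> hi [g [t [m [gi e]]]]; exists (g \o h), t, m; split=> //.
exact: isom_comp gi hi.
Qed.

Let normal_unit1 x y k : (p %| y - 1)%Z -> normalizable ((x, y), k).
Proof.
move=> /dvdzP[w yw]; have [q kq] := osum_even hplane_even evK (- k).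
have ei := eichler_isom kq.
have y1 : y = 1 + w * p by rewrite -yw addrC subrK.
(* [p] divides [k - y k], which is what is left of the component [k]. *)
exists (eichler (- k) q), (x - lform k (- k) - q * y), ((0, w), - k *~ w).
split; first exact: ei.
rewrite /eichler /= (pairMz (0, w)) (pairMz 0 w) {}y1 mul0rz; congr ((_, _), _) => /=.
- by rewrite addr0.
- by rewrite mulrzz.
- by rewrite mulrzDr mulr1z addrA subrr add0r add0r mulrzA.
Qed.

Let normal_unit2 x y k : ~~ (p %| y)%Z -> normalizable ((x, y), k).
Proof.
move=> py; have [c [w cy]] := prime_inv_int p_prime py.
case: k => [[x2 y2] k].
(* The Eichler map adds [y * c * (1 - y2)], that is, [1 - y2], to [y2]. *)
pose a : osum hplane K := ((0, c * (1 - y2)), 0).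
have aa : lform a a = 2 * 0.
  by rewrite osumE hplaneE lform0l /=; ring.
apply: (normalizable_isom (eichler_isom aa)).
apply: (normalizable_isom (exchange_isom hplane hplane K)).
apply: normal_unit1.
apply/dvdzP; exists (w * (1 - y2)); rewrite /= !pairMz /= mulrzz.
have -> : y2 + c * (1 - y2) * y - 1 = (1 - y2) * (c * y) - (1 - y2) by ring.
by rewrite cy; ring.
Qed.

Let normal_unit3 x y k : ~~ (p %| x)%Z -> normalizable ((x, y), k).
Proof.
move=> px; apply: (normalizable_isom (hswap_isom _)); exact: normal_unit2.
Qed.

(** The coefficient along the second basis vector of the first plane is the
    lever: once it is [1] modulo [p], an Eichler map clears the component
    in the rest of the lattice. Eichler maps and swaps serve to make it a unit;
    if it is one already, an Eichler map puts the value [1] into the second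
    plane, and exchanging the planes brings it back. *)
Lemma orbit_normal_form (l a : M) : ~~ (p %| lform l a)%Z -> normalizable l.
Proof.
case: l a => [[x y] k] [[x' y'] k'] la.
have [py|] := boolP (p %| y)%Z; last exact: normal_unit2.
have [px|] := boolP (p %| x)%Z; last exact: normal_unit3.
have kk : ~~ (p %| lform k k')%Z.
  apply: contra la => pk; rewrite osumE hplaneE /=.
  by rewrite rpredD // rpredD // dvdz_mulr.
have [q kq] := osum_even hplane_even evK k'.
apply: (normalizable_isom (eichler_isom kq)); apply: normal_unit3 => /=.
apply: contra kk => px1.
have -> : lform k k' = x - q * y - (x - lform k k' - q * y) by ring.
by apply: rpredB px1; apply: rpredB => //; apply: dvdz_mull.
Qed.
End Orbit.

(** * Normal forms of kernels of functionals *)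

Lemma dvdz_congr (p u v : int) : (p %| u - v)%Z -> (p %| u)%Z = (p %| v)%Z.
Proof. by move=> puv; rewrite -[u](subrK v) rpredDl. Qed.

Section NormalForm.
Variables (p : nat).

(** The kernel of [x + t y] on the hyperbolic plane has the basis
    [f - t e, p e], whose Gram matrix is [[- 2 t, p], [p, 0]]. *)
Lemma realizes_standard (t : int) (W : zlattice) : (0 < p)%N ->
  realizes (osum (lattice2 (2 * - t) p) W)
    (fun X : osum hplane W => (p %| X.1.1 + t * X.1.2)%Z).
Proof.
move=> p_gt0; have p0 : p%:Z != 0 by case: p p_gt0.
exists (fun Y => ((p%:Z * Y.1.2 - t * Y.1.1, Y.1.1), Y.2)); split.
- move=> [[x y] k] [[x' y'] k'] /=; congr (_, _, _); rewrite /=; ring.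
- move=> [[x y] k] [[x' y'] k'] /= [e xx ->].
  by move: e; rewrite xx => /addIr/(mulfI p0)->.
- move=> [[x y] k] [[x' y'] k'].
  by rewrite !osumE lattice2E hplaneE /=; ring.
- move=> [[x y] k] /=; split.
  + move=> /dvdzP[w xy]; exists ((y, w), k) => /=.
    by rewrite mulrC -xy addrK.
  + by move=> [[[x' y'] k'] /= [<- <- _]]; rewrite subrK dvdz_mulr.
Qed.

(** The congruence on the norm of [l] identifies the parameter [t'] of its normal
    form with [t] modulo [p], as [p] is odd. *)
Lemma realizes_vector (K : zlattice) (l a : osum hplane (osum hplane K))
    (t : int) :
  prime p -> odd p -> even_lattice K -> ~~ (p %| lform l a)%Z ->
  (p %| lform l l - 2 * t)%Z ->
  realizes (osum (lattice2 (2 * - t) p) (osum hplane K))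
    (fun X => (p %| lform l X)%Z : Prop).
Proof.
move=> pp podd evK la ll.
have [g [t' [m [gi gl]]]] := orbit_normal_form pp evK la.
have [_ _ gf] := gi.
have tt : (p %| t' - t)%Z.
  have : (p %| 2 * (t' - t))%Z.
    have -> : 2 * (t' - t) = (lform l l - 2 * t) -
      (2 * lform (((t', 1), 0) : osum hplane (osum hplane K)) m + p%:Z * lform m m) * p%:Z.
      rewrite -gf gl !(lformDl, lformDr, lformMzl, lformMzr).
      rewrite (lformC m (_, _)).
      have -> : lform (((t', 1), 0) : osum hplane (osum hplane K)) ((t', 1), 0)
        = 2 * t' by rewrite osumE hplaneE lform0l /=; ring.
      by ring.
    by apply: rpredB => //; apply: dvdz_mull.
  by rewrite Gauss_dvdzr // coprimezE /= coprimen2.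
have [g' [g'i gK g'K]] := isom_inv gi.
apply: (realizes_isom g'i _ (realizes_standard t _ (prime_gt0 pp))) => X.
have e0 : lform (((t', 1), 0) : osum hplane (osum hplane K)) X =
    X.1.1 + t' * X.1.2.
  by rewrite osumE hplaneE lform0l /=; ring.
rewrite -gf g'K gl lformDl lformMzl {}e0.
case: X => [[x y] k] /=.
set u := (X in (_ <-> is_true (_ %| X)%Z)).
have e : u - (x + t * y) =
    (t' - t) * y + lform m (((x, y) : hplane, k) : osum hplane (osum hplane K)) * p%:Z.
  by rewrite /u; ring.
have : (p %| u - (x + t * y))%Z by rewrite e; apply: rpredD; [apply: dvdz_mulr | apply: dvdz_mull].
by move=> /dvdz_congr->.
Qed.
End NormalForm.

Section TwistedForm.
Variables (p : nat) (n : int) (E : zlattice).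
Hypotheses (p_gt0 : (0 < p)%N) (pn : (p %| n)%Z) (evE : even_lattice E).
Local Notation M := (osum hplane (osum hplane (osum (lattice1 (2 * n)) E))).

(** The product with the vector whose components in the two planes and in [E] are
    [(s, t)] and [a], plus the coordinate along the generator of norm [2 n]. *)
Definition twisted (t s : int) (a : osum hplane E) (X : M) : int :=
  t * X.1.1 + s * X.1.2 +
  (X.2.2.1 + lform a (((X.2.1 : hplane), (X.2.2.2 : E)) : osum hplane E)).

Local Notation N :=
  (osum hplane (osum hplane (osum (lattice1 (2 * n * p ^+ 2)) E))).
Local Notation realized t s a := (realizes N (fun X : M => (p %| twisted t s a X)%Z)).

Let realized_swap t s a : realized s t a -> realized t s a.
Proof.
apply: realizes_isom (hswap_isom _) _ => X.
by rewrite /twisted /= [s * _ + _]addrC.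
Qed.

Let realized_shift t s a (c : int) : realized t (s + c) a -> realized t s a.
Proof.
pose A : osum hplane (osum (lattice1 (2 * n)) E) := (0, (c, 0)).
have AA : lform A A = 2 * (n * (c * c)).
  by rewrite !osumE lattice1E !lform0l /=; ring.
apply: realizes_isom (eichler_isom AA) _ => -[[x y] [u [z e]]].
set v := twisted _ _ _ _; set w := twisted _ _ _ _.
have wv : w - v = n * - (t * (2 * (z * c) + c * c * y)).
  rewrite /w /v /twisted /= !pairMz /=.
  rewrite !osumE lattice1E /= !lform0r !lformDr !lformMzr !lform0r mulrzz.
  by rewrite mul0rz (lform0r a.1); ring.
have : (p %| w - v)%Z by rewrite wv dvdz_mulr.
by move=> /dvdz_congr->.
Qed.

Let realized_clear s a :
  (forall s', realized 1 s' 0) -> realized 1 s a.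
Proof.
pose A : osum hplane (osum (lattice1 (2 * n)) E) := (a.1, (0, a.2)).
have evA := osum_even hplane_even (osum_even (lattice1_even (n := n)) evE).
have [q AA] := evA A.
move=> /(_ (s - q + lform A A)).
apply: realizes_isom (eichler_isom AA) _ => -[[x y] [u [z e]]].
suff -> : twisted 1 s a (eichler A q ((x, y), (u, (z, e)))) =
   twisted 1 (s - q + lform A A) 0 ((x, y), (u, (z, e))) by [].
rewrite /twisted /= lform0l !pairMz /=.
rewrite !osumE lattice1E /= !lformDr !lformMzr (lformC u) (lformC e) mul0rz lform0l.
by ring.
Qed.
Let realized_plain : realized 0 0 0.
Proof.
have p0 : p%:Z != 0 by case: p p_gt0.
exists (fun Y : N => (Y.1, (Y.2.1, (p%:Z * Y.2.2.1, Y.2.2.2)))); split.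
- move=> [u [v [z e]]] [u' [v' [z' e']]] /=.
  by congr (_, (_, (_, _))); rewrite /= mulrBr.
- by move=> [u [v [z e]]] [u' [v' [z' e']]] /= [-> -> /(mulfI p0)-> ->].
- move=> [u [v [z e]]] [u' [v' [z' e']]].
  by rewrite !osumE !lattice1E /=; ring.
- move=> [u [v [z e]]]; rewrite /twisted lform0l !mul0r !(add0r, addr0) /=.
  split=> [/dvdzP[w zw]|[[u' [v' [z' e']]] /= [_ _ <- _]]].
    by exists (u, (v, (w, e))); rewrite /= zw mulrC.
  exact: dvdz_mulr.
Qed.

(** A functional with coefficient [1] on a vector of norm divisible by [p] is
    moved to the mere coordinate along that vector: modulo [p], Eichler maps
    in its direction change [t] and [s] at will and leave the rest alone, and
    once [t] is a unit one more Eichler map clears [a]. *)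
Lemma realizes_twisted t s a :
  realizes N (fun X : M => (p %| twisted t s a X)%Z).
Proof.
apply/realized_swap/(@realized_shift _ _ _ (1 - t)); rewrite addrC subrK.
apply/realized_swap/realized_clear => s'.
apply: (@realized_shift _ _ _ (- s')); rewrite subrr.
apply/realized_swap/(@realized_shift _ _ _ (- 1)); rewrite subrr.
exact: realized_plain.
Qed.
End TwistedForm.

(** * The lattice E_8 and unimodularity *)

Lemma E8neg_sym : E8neg_mx^T = E8neg_mx.
Proof. by apply/matrixP => i j; rewrite !mxE eq_sym orbC. Qed.

Definition E8neg : zlattice := gram_lattice E8neg_sym.

Definition seqs_mx (n : nat) (s : seq (seq int)) : 'M[int]_n :=
  \matrix_(i, j) nth 0 (nth [::] s i) j.

Definition E8neg_inv : 'M[int]_8 := seqs_mx 8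
  [:: [:: -4; -7; -10; -8; -6; -4; -2; -5];
      [:: -7; -14; -20; -16; -12; -8; -4; -10];
      [:: -10; -20; -30; -24; -18; -12; -6; -15];
      [:: -8; -16; -24; -20; -15; -10; -5; -12];
      [:: -6; -12; -18; -15; -12; -8; -4; -9];
      [:: -4; -8; -12; -10; -8; -6; -3; -6];
      [:: -2; -4; -6; -5; -4; -3; -2; -3];
      [:: -5; -10; -15; -12; -9; -6; -3; -8]].

(** Twice the coordinates of the simple roots of [E_8] in an orthonormal basis
    of the ambient space. *)
Definition E8_roots : 'M[int]_8 := seqs_mx 8
  [:: [:: -1; -1; -1; -1; -1; -1; 1; 1];
      [:: 0; 0; 0; 0; 0; 2; -2; 0];
      [:: 0; 0; 0; 0; 2; -2; 0; 0];
      [:: 0; 0; 0; 2; -2; 0; 0; 0];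
      [:: 0; 0; 2; -2; 0; 0; 0; 0];
      [:: 0; 2; -2; 0; 0; 0; 0; 0];
      [:: 2; -2; 0; 0; 0; 0; 0; 0];
      [:: 0; 0; 0; 0; 0; 2; 2; 0]].

Ltac ord8 i := case: i => [] [|[|[|[|[|[|[|[|//]]]]]]]] ?.

Lemma E8neg_mulV : E8neg_mx *m E8neg_inv = 1%:M.
Proof.
apply/matrixP => i j; rewrite !mxE !big_ord_recl big_ord0 !mxE.
by ord8 i; ord8 j.
Qed.

Lemma E8_roots_gram : E8_roots *m E8_roots^T = (- 4) *: E8neg_mx.
Proof.
apply/matrixP => i j; rewrite !mxE !big_ord_recl big_ord0 !mxE.
by ord8 i; ord8 j.
Qed.

Lemma E8neg_even : even_lattice E8neg.
Proof.
(* [E8neg_mx] is [T + T^T] for an integral matrix [T]. *)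
pose T : 'M[int]_8 := \matrix_(i, j) (if i == j then - 1 else (E8_edge i j)%:R).
have eT : E8neg_mx = T + T^T.
  by apply/matrixP => i j; rewrite !mxE; ord8 i; ord8 j.
move=> x; exists ((x *m T *m x^T) 0 0).
rewrite -[lform x x]/((x *m E8neg_mx *m x^T) 0 0) eT mulmxDr mulmxDl.
have -> : x *m T^T *m x^T = (x *m T *m x^T)^T.
  by rewrite !trmx_mul trmxK mulmxA.
move: (x *m T *m x^T) => c; rewrite !mxE; ring.
Qed.

Definition representable (M : zlattice) (f : M -> int) : Prop :=
  exists x, forall y, f y = lform x y.

Definition unimodular (M : zlattice) : Prop :=
  forall f : M -> int, zmod_morphism f -> representable f.

Lemma zmod_morphismMz (U V : zmodType) (f : U -> V) (x : U) (n : int) :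
  zmod_morphism f -> f (x *~ n) = f x *~ n.
Proof.
move=> fB; pose F : {additive U -> V} :=
  HB.pack f (GRing.isZmodMorphism.Build U V f fB).
exact: (raddfMz F).
Qed.

Lemma zmod_morphismD (U V : zmodType) (f : U -> V) (x y : U) :
  zmod_morphism f -> f (x + y) = f x + f y.
Proof.
move=> fB; pose F : {additive U -> V} :=
  HB.pack f (GRing.isZmodMorphism.Build U V f fB).
exact: (raddfD F).
Qed.

Lemma zmod_morphism_sum (U V : zmodType) (f : U -> V) n (x : 'I_n -> U) :
  zmod_morphism f -> f (\sum_i x i) = \sum_i f (x i).
Proof.
move=> fB; pose F : {additive U -> V} :=
  HB.pack f (GRing.isZmodMorphism.Build U V f fB).
exact: (raddf_sum F).
Qed.

Lemma zmod_morphism_row (V : zmodType) n (f : 'rV[int]_n -> V) (x : 'rV[int]_n) :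
  zmod_morphism f -> f x = \sum_i f (delta_mx 0 i) *~ x 0 i.
Proof.
move=> fB; rewrite {1}[x]row_sum_delta zmod_morphism_sum //.
by apply: eq_bigr => i _; rewrite -{1}[x 0 i]intz scaler_int zmod_morphismMz.
Qed.

Lemma gram_unimodular n (A B : 'M[int]_n) (sA : A^T = A) :
  B *m A = 1%:M -> unimodular (gram_lattice sA).
Proof.
move=> BA f fB; pose u := \row_i f (delta_mx 0 i).
exists (u *m B) => y.
rewrite /lform /= /gram_form -mulmxA -(mulmxA u) (mulmxA B) BA mul1mx mxE.
rewrite zmod_morphism_row //; apply: eq_bigr => i _.
by rewrite !mxE -mulrzr intz.
Qed.

Lemma E8neg_unimodular : unimodular E8neg.
Proof. exact: gram_unimodular (mulmx1C E8neg_mulV). Qed.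

Lemma representable_osum (M N : zlattice) (f : osum M N -> int) :
  zmod_morphism f ->
  representable f <-> representable (fun x : M => f (x, 0)) /\
                      representable (fun y : N => f (0, y)).
Proof.
move=> fB; split.
- move=> [[x y] xy]; split.
  + by exists x => z; rewrite xy osumE /= lform0r addr0.
  + by exists y => z; rewrite xy osumE /= lform0r add0r.
- move=> [[x fx] [y fy]]; exists (x, y) => -[z w].
  rewrite osumE /= -fx -fy -zmod_morphismD //.
  by congr f; congr (_, _); rewrite /= ?addr0 ?add0r.
Qed.

Lemma zmod_morphism_inl (M N : zlattice) (f : osum M N -> int) :
  zmod_morphism f -> zmod_morphism (fun x : M => f (x, 0)).
Proof.
by move=> fB x y; rewrite -fB; congr f; congr (_, _); rewrite /= subrr.
Qed.

Lemma zmod_morphism_inr (M N : zlattice) (f : osum M N -> int) :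
  zmod_morphism f -> zmod_morphism (fun y : N => f (0, y)).
Proof.
by move=> fB x y; rewrite -fB; congr f; congr (_, _); rewrite /= subrr.
Qed.

Lemma osum_unimodular (M N : zlattice) :
  unimodular M -> unimodular N -> unimodular (osum M N).
Proof.
move=> uM uN f fB; apply/representable_osum => //; split.
- exact/uM/zmod_morphism_inl.
- exact/uN/zmod_morphism_inr.
Qed.

Lemma zmod_morphism_int (f : int -> int) (x : int) :
  zmod_morphism f -> f x = f 1 * x.
Proof.
by move=> fB; rewrite -{1}[x]intz zmod_morphismMz // -mulrzr intz.
Qed.

Lemma zmod_morphism_int2 (f : int * int -> int) (x : int * int) :
  zmod_morphism f -> f x = f (1, 0) * x.1 + f (0, 1) * x.2.
Proof.
move=> fB; have {1}-> : x = (1, 0) *~ x.1 + (0, 1) *~ x.2.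
  case: x => x y; rewrite !pairMz !mul0rz !intz.
  by congr (_, _); rewrite /= ?addr0 ?add0r.
by rewrite (zmod_morphismD _ _ fB) !(zmod_morphismMz _ _ fB) !mulrzz.
Qed.

Lemma representable_lattice1 n (f : lattice1 n -> int) : zmod_morphism f ->
  representable f <-> (n %| f 1)%Z.
Proof.
move=> fB; split.
- by move=> [x fx]; rewrite fx lattice1E dvdz_mulr.
- move=> /dvdzP[x fx]; exists x => y.
  by rewrite lattice1E zmod_morphism_int // fx; ring.
Qed.

Lemma representable_lattice2 a b (f : lattice2 a b -> int) : zmod_morphism f ->
  representable f <->
  exists x y, f (1, 0) = a * x + b * y /\ f (0, 1) = b * x.
Proof.
move=> fB; split.
- by move=> [[x y] fx]; exists x, y; rewrite !fx !lattice2E /=; split; ring.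
- move=> [x [y [f1 f2]]]; exists (x, y) => z.
  by rewrite lattice2E zmod_morphism_int2 // f1 f2 /=; ring.
Qed.

Lemma hplane_unimodular : unimodular hplane.
Proof.
move=> f fB; apply/representable_lattice2 => //.
by exists (f (0, 1)), (f (1, 0)); rewrite mul0r add0r !mul1r.
Qed.

(** * Discriminant groups through functionals on the dual *)

Section DiscriminantModel.
Local Open Scope quotient_scope.
Variable M : zlattice.

Definition discr_class (f : dual_group M) : discr M := \pi f.

Lemma discr_classP (f g : dual_group M) :
  discr_class f = discr_class g <-> embed_set (f - g).
Proof.
split=> [fg|fg].
- have : (f - g) \in sg_pred (Subgroup (@embed0 M) (@embedB M)).
    by rewrite Quotient.idealrBE; apply/eqP.
  by move=> /asboolP.
- by apply/eqP; rewrite -Quotient.idealrBE; apply: asboolT.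
Qed.

Lemma discr_class_surj (x : discr M) : exists f, x = discr_class f.
Proof. by exists (repr x); rewrite /discr_class reprK. Qed.

Lemma discr_classB : zmod_morphism discr_class.
Proof.
move=> f g; rewrite /discr_class.
by rewrite (Quotient.pi_add _ f (- g)) (Quotient.pi_opp _ g).
Qed.

(** A concrete presentation of the discriminant group: a surjection from the dual
    whose kernel is the image of the lattice. Unlike the quotient itself, it is
    transported along isometries by mere composition. *)
Definition discr_model (A : zmodType) (F : dual_group M -> A) : Prop :=
  [/\ zmod_morphism F, forall a, exists f, F f = a
    & forall f, F f = 0 <-> embed_set f].

Variables (A : zmodType) (F : dual_group M -> A).
Hypothesis modelF : discr_model F.

Lemma discr_model_eq (f g : dual_group M) :
  discr_class f = discr_class g <-> F f = F g.
Proof.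
have [FB _ F0] := modelF; rewrite discr_classP -F0 FB.
by split=> [/eqP|->]; rewrite ?subrr // subr_eq0 => /eqP.
Qed.

Lemma discr_model_lift : exists Fb : {additive discr M -> A},
  bijective Fb /\ forall f, Fb (discr_class f) = F f.
Proof.
have [FB FS F0] := modelF.
pose Fb (x : discr M) := F (repr x).
have FbE f : Fb (discr_class f) = F f.
  by apply/discr_model_eq; rewrite {1}/discr_class reprK.
have FbB : zmod_morphism Fb.
  move=> x y; have [f ->] := discr_class_surj x.
  by have [g ->] := discr_class_surj y; rewrite -discr_classB !FbE FB.
pose Fa : {additive discr M -> A} :=
  HB.pack Fb (GRing.isZmodMorphism.Build _ _ Fb FbB).
exists Fa; split; last exact: FbE.
apply: inj_surj_bij => [x y|a].
- have [f ->] := discr_class_surj x; have [g ->] := discr_class_surj y.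
  by rewrite [Fa _]FbE [Fa _]FbE => /discr_model_eq.
- by have [f <-] := FS a; exists (discr_class f); apply: FbE.
Qed.

Lemma discr_model_iso : group_iso (discr M) A.
Proof. by have [Fb [bFb _]] := discr_model_lift; exists Fb. Qed.
End DiscriminantModel.

Definition mkdual (M : zlattice) (f : M -> int) (fB : zmod_morphism f) :
  dual_group M := exist _ f (asboolT fB : f \in sg_pred (Subgroup (@hom0 M) (@homB M))).

Lemma dualB (M : zlattice) (f : dual_group M) : zmod_morphism (val f).
Proof. by have /asboolP := valP f. Qed.

Lemma dual_eq (M : zlattice) (f g : dual_group M) :
  (forall x, val f x = val g x) -> f = g.
Proof. by move=> fg; apply/val_inj/funext. Qed.

Lemma embed_setP (M : zlattice) (f : dual_group M) :
  embed_set f <-> representable (val f).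
Proof. by []. Qed.

Section Pullback.
Variables (M N : zlattice) (g : M -> N).
Hypothesis gi : isom g.

Lemma pullback_subproof (f : dual_group N) : zmod_morphism (fun x => val f (g x)).
Proof. by have [gB _ _] := gi; move=> x y; rewrite gB dualB. Qed.

Definition pullback (f : dual_group N) : dual_group M :=
  mkdual (pullback_subproof f).

Lemma pullbackB : zmod_morphism pullback.
Proof. by move=> f f'; apply: dual_eq. Qed.

Lemma pullback_fraction (f : dual_group N) (n : int) (x : M) :
  is_fraction (pullback f) (n, x) <-> is_fraction f (n, g x).
Proof.
have [_ [h gK hK] gf] := gi.
split=> -[n0 /= fx]; split=> //= y; last by rewrite fx gf.
by rewrite -[y]hK gf -fx.
Qed.

Lemma pullback_embed (f : dual_group N) : embed_set (pullback f) <-> embed_set f.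
Proof.
have [_ [h gK hK] gf] := gi.
split=> [[x fx]|[x fx]].
- by exists (g x) => y; rewrite -[y]hK gf -fx.
- by exists (h x) => y; rewrite -gf hK -fx.
Qed.

Lemma pullback_surj (f : dual_group M) : exists f', pullback f' = f.
Proof.
have [gB [h gK hK] gf] := gi.
have hB : zmod_morphism h.
  by move=> x y; apply: (can_inj gK); rewrite gB !hK.
have fB : zmod_morphism (fun y => val f (h y)).
  by move=> x y; rewrite hB dualB.
by exists (mkdual fB); apply: dual_eq => x /=; rewrite gK.
Qed.

Lemma pullback_model (A : zmodType) (F : dual_group M -> A) :
  discr_model F -> discr_model (F \o pullback).
Proof.
move=> [FB FS F0]; split.
- by move=> f f' /=; rewrite pullbackB FB.
- move=> a; have [f <-] := FS a; have [f' <-] := pullback_surj f.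
  by exists f'.
- by move=> f; rewrite -pullback_embed -F0.
Qed.
End Pullback.

Lemma Zp_intr_eq0 (N : nat) (k : int) : (1 < N)%N ->
  (k%:~R = 0 :> 'Z_N) <-> (N %| k)%Z.
Proof.
move=> N1; suff nat_case (n : nat) : (n%:R = 0 :> 'Z_N) <-> (N %| n)%N.
  case: k => n; first by rewrite -pmulrn; apply: nat_case.
  rewrite NegzE mulrNz dvdzE abszN -pmulrn -[in X in _ <-> X]nat_case.
  by split=> [/eqP|->]; rewrite ?oppr0 // oppr_eq0 => /eqP.
rewrite -(@Zp_nat_mod N) // /dvdn; split.
- move=> /(congr1 val); rewrite /= val_Zp_nat // modn_mod => ->; exact: eqxx.
- by move=> /eqP->.
Qed.

Lemma Zp_intr_surj (N : nat) (a : 'Z_N) : exists k : int, k%:~R = a.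
Proof. by exists (a : nat)%:Z; rewrite -pmulrn natr_Zp. Qed.

Section CyclicDiscriminant.
Local Open Scope quotient_scope.

(** The value of the discriminant form at the class of [f = x / n] is
    [(x, x) / n ^ 2 = - k / N]. *)
Definition cyclic_discr (M : zlattice) (N : nat) (k : int) : Prop :=
  exists (F : dual_group M -> 'Z_N) (f : dual_group M) (n : int) (x : M),
  [/\ discr_model F, exists l, F f *~ l = 1, is_fraction f (n, x)
    & - N%:Z * lform x x = k * n ^+ 2].

Lemma cyclic_discr_isometric (M M' : zlattice) (N : nat) (k : int) :
  isometric M M' -> cyclic_discr M N k -> cyclic_discr M' N k.
Proof.
move=> /isometric_isom[g gi] [F [f [n [x [modF [l Ff] fx kx]]]]].
have [h [hi gK hK]] := isom_inv gi.
have [f' ff'] := pullback_surj gi f.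
have [_ _ gf] := gi.
suff [F' modF' F'f'] : exists2 F' : dual_group M' -> 'Z_N,
    discr_model F' & F' f' = F f.
  exists F', f', n, (g x); split; first exact: modF'.
  - by exists l; rewrite F'f'.
  - by apply: (proj1 (pullback_fraction gi f' n x)); rewrite ff'.
  - by rewrite gf.
by exists (F \o pullback gi); [apply: pullback_model | rewrite /= ff'].
Qed.

Lemma mod2Z_eq (r s : rat) : mod2Z r = mod2Z s ->
  exists j : int, r = s + (2 * j)%:~R.
Proof.
move=> /eqP; rewrite /mod2Z -Quotient.idealrBE => /asboolP[j rs].
by exists j; rewrite -rs addrC subrK.
Qed.

Lemma fractionMz (M : zlattice) (f : dual_group M) (n m : int) (x : M) :
  is_fraction f (n, x) -> is_fraction (f *~ m) (n, x *~ m).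
Proof.
move=> [n0 /= fx]; split=> //= y.
have valB : zmod_morphism (fun f : dual_group M => val f y) by [].
rewrite (zmod_morphismMz f m valB) lformMzl -fx -mulrzr intz; ring.
Qed.

Lemma discr_classMz (M : zlattice) (f : dual_group M) (m : int) :
  discr_class (f *~ m) = discr_class f *~ m.
Proof. exact: (zmod_morphismMz _ _ (@discr_classB M)). Qed.

(** Two generators of a cyclic group of order [N] are multiples [m] and [m'] of
    each other with [m m' = 1] modulo [N], and the form is quadratic. *)
Lemma cyclic_discrP (M : zlattice) (N : nat) (k : int) :
  (1 < N)%N -> even_lattice M -> cyclic_discr M N k ->
  [/\ group_iso (discr M) 'Z_N,
      exists v : discr M, generates v /\ represents (- N%:Z) v k
    & forall (v : discr M) k', generates v -> represents (- N%:Z) v k' ->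
      exists m m' j : int, (N %| m * m' - 1)%Z /\ k' = m ^+ 2 * k + N%:Z * j].
Proof.
move=> N1 evM [F [f [n [x [modF [l Ffl] fx kx]]]]].
have [FB _ _] := modF.
have [n0 _] := fx.
have n0q : n%:~R != 0 :> rat by rewrite intr_eq0.
have gen_f : generates (discr_class f).
  move=> w; have [g ->] := discr_class_surj w.
  have [a ag] := Zp_intr_surj (F g).
  exists (l * a); rewrite -discr_classMz; apply/(discr_model_eq modF).
  by rewrite (zmod_morphismMz _ _ FB) mulrzA Ffl ag.
have formE m : discr_form (discr_class (f *~ m)) =
    mod2Z ((lform x x)%:~R * m%:~R ^+ 2 / n%:~R ^+ 2).
  have fmx := fractionMz m fx.
  rewrite (discr_formE evM fmx) (dual_formE fmx fmx).
  rewrite lformMzl lformMzr !intrM !expr2; congr (mod2Z (_ / _)).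
  by ring.
have kxq : (- N%:Z)%:~R * (lform x x)%:~R = k%:~R * n%:~R ^+ 2 :> rat.
  by rewrite -intrM kx intrM rmorphXn.
split; first exact: discr_model_iso modF.
  exists (discr_class f); split=> //.
  exists ((lform x x)%:~R / n%:~R ^+ 2); split.
    by rewrite -[f]mulr1z formE expr1n mulr1.
  by rewrite mulrA kxq mulfK // expf_neq0.
move=> v k' gen_v [r [rv rk']].
have [m vm] := gen_f v; have [m' fm'] := gen_v (discr_class f).
have : discr_class (f *~ (m * m')) = discr_class f.
  by rewrite discr_classMz mulrzA -vm -fm'.
move=> /(discr_model_eq modF); rewrite (zmod_morphismMz _ _ FB) => Fmm'.
have Nmm' : (N %| m * m' - 1)%Z.
  apply/Zp_intr_eq0 => //; rewrite -[(_ - _)%:~R]mulrzl mulr1 -Ffl.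
  by rewrite -mulrzA mulrC mulrzA mulrzBr Fmm' mulr1z subrr mul0rz.
move: rv; rewrite vm -discr_classMz formE => /mod2Z_eq[j rj].
exists m, m', (- (2 * j)); split=> //; apply: (@intr_inj rat).
rewrite -rk' rj mulrDr [RHS]intrD; congr (_ + _).
  rewrite !mulrA kxq mulrAC [_ * _ / _]mulrAC mulfK ?expf_neq0 //.
  by rewrite expr2 !intrM; ring.
by rewrite -intrM mulNr mulrN.
Qed.
End CyclicDiscriminant.

(** * Discriminant groups of the normal forms *)

Definition split_lattice (E : zlattice) (d p : nat) (t : int) : zlattice :=
  osum (lattice2 (2 * - t) p) (osum hplane (osum (lattice1 (2 * - d%:Z)) E)).

Definition twisted_lattice (E : zlattice) (d p : nat) : zlattice :=
  osum hplane (osum hplane (osum (lattice1 (2 * - d%:Z * p%:Z ^+ 2)) E)).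

Lemma coprimez_prime (p : nat) (k : int) : prime p ->
  coprimez p k = ~~ (p %| k)%Z.
Proof. by move=> pp; rewrite coprimezE dvdzE prime_coprime. Qed.

Lemma dvdz2_odd (p : nat) : prime p -> odd p -> ~~ (p %| 2%:Z)%Z.
Proof. by move=> pp podd; rewrite dvdzE -prime_coprime // coprimen2. Qed.

Section SplitDiscriminant.
Variables (E : zlattice) (d p : nat) (t : int).
Hypotheses (uE : unimodular E) (d_gt0 : (0 < d)%N) (p_prime : prime p).
Local Notation M := (split_lattice E d p t).
Implicit Types f : dual_group M.

Definition fiber_val f : int := val f (0, (0, (1, 0))).
Definition plane_val1 f : int := val f ((1, 0), 0).
Definition plane_val2 f : int := val f ((0, 1), 0).

(** The two unimodular summands impose no condition. *)
Lemma split_embed f : embed_set f <->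
  (2 * d%:Z %| fiber_val f)%Z /\
  exists x y, plane_val1 f = 2 * - t * x + p%:Z * y /\ plane_val2 f = p%:Z * x.
Proof.
have fB := dualB f; rewrite embed_setP representable_osum //.
have f1B := zmod_morphism_inl fB; have f2B := zmod_morphism_inr fB.
rewrite representable_lattice2 // representable_osum //.
have f3B := zmod_morphism_inr f2B.
rewrite representable_osum // representable_lattice1; last first.
  exact: (zmod_morphism_inl f3B).
rewrite [2 * - d%:Z]mulrN dvdzE abszN -dvdzE; split.
  by move=> [H1 [_ [H2 _]]]; split.
move=> [H1 H2]; split; first exact: H2.
split; first by apply: hplane_unimodular; apply: zmod_morphism_inl f2B.
by split; [exact: H1 | apply: uE; apply: zmod_morphism_inr f3B].
Qed.

Lemma split_dual (a b c : int) : exists f,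
  [/\ fiber_val f = a, plane_val1 f = b, plane_val2 f = c
    & forall X, val f X = a * X.2.2.1 + (b * X.1.1 + c * X.1.2)].
Proof.
pose g (X : M) : int := a * X.2.2.1 + (b * X.1.1 + c * X.1.2).
have gB : zmod_morphism g.
  by move=> [[x y] [u [z e]]] [[x' y'] [u' [z' e']]]; rewrite /g /=; ring.
by exists (mkdual gB); rewrite /fiber_val /plane_val1 /plane_val2 /= /g /=; split=> //; ring.
Qed.

(** The plane with Gram matrix [[- 2 t, p], [p, 0]] has a cyclic discriminant
    group of order [p ^ 2] for [t] prime to [p]: its image in the dual is cut out
    by a single congruence. *)
Lemma split_unit_embed f : odd p -> ~~ (p %| t)%Z -> embed_set f <->
  (2 * d%:Z %| fiber_val f)%Z /\
  (p%:Z ^+ 2 %| p%:Z * plane_val1 f + 2 * t * plane_val2 f)%Z.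
Proof.
move=> podd pt; rewrite split_embed; split=> -[H1 H2]; split=> // {H1}.
- have [x [y [-> ->]]] := H2; apply/dvdzP; exists y; ring.
- have p0 : p%:Z != 0 by have := prime_gt0 p_prime; case: p.
  have /dvdzP[w wE] := H2.
  have p2t : coprimez p (2 * t).
    by rewrite coprimezMr !coprimez_prime // pt andbT dvdz2_odd.
  have /dvdzP[x xE] : (p %| plane_val2 f)%Z.
    rewrite -(@Gauss_dvdzr p (2 * t)) //; apply/dvdzP; exists (w * p - plane_val1 f).
    by rewrite -[LHS](addKr (p%:Z * plane_val1 f)) wE; ring.
  exists x, w; rewrite {1}xE; split; last by rewrite mulrC.
  apply: (mulfI p0); apply: (addIr (2 * t * plane_val2 f)); rewrite wE xE; ring.
Qed.

Lemma split_discr_isotropic : t = 0 ->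
  group_iso (discr M) ('Z_(2 * d) * 'Z_p * 'Z_p)%type.
Proof.
move=> t0; have p1 := prime_gt1 p_prime; have d1 : (1 < 2 * d)%N by lia.
pose F f : ('Z_(2 * d) * 'Z_p * 'Z_p)%type :=
  ((fiber_val f)%:~R, (plane_val1 f)%:~R, (plane_val2 f)%:~R).
apply: (@discr_model_iso _ _ F); split.
- by move=> f g; rewrite /F; congr (_, _, _); rewrite -intrB.
- move=> [[a b] c]; have [a' <-] := Zp_intr_surj a.
  have [b' <-] := Zp_intr_surj b; have [c' <-] := Zp_intr_surj c.
  by have [f [fa fb fc _]] := split_dual a' b' c'; exists f; rewrite /F fa fb fc.
- move=> f; rewrite split_embed t0; split.
  + move=> [/Zp_intr_eq0-/(_ d1) ? /Zp_intr_eq0-/(_ p1)/dvdzP[y ->]].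
    move=> /Zp_intr_eq0-/(_ p1)/dvdzP[x ->]; split=> //.
    by exists x, y; split; ring.
  + move=> [H [x [y [e1 e2]]]]; congr (_, _, _); apply/Zp_intr_eq0 => //.
      by rewrite e1 oppr0 mulr0 mul0r add0r dvdz_mulr.
    by rewrite e2 dvdz_mulr.
Qed.

Lemma split_discr_unit : odd p -> ~~ (p %| t)%Z ->
  group_iso (discr M) ('Z_(2 * d) * 'Z_(p ^ 2))%type.
Proof.
move=> podd pt; have d1 : (1 < 2 * d)%N by lia.
have p1 : (1 < p ^ 2)%N by rewrite -(exp1n 2) ltn_exp2r // prime_gt1.
pose F f : ('Z_(2 * d) * 'Z_(p ^ 2))%type :=
  ((fiber_val f)%:~R, (p%:Z * plane_val1 f + 2 * t * plane_val2 f)%:~R).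
apply: (@discr_model_iso _ _ F); split.
- move=> f g; rewrite /F; congr (_, _); rewrite -intrB //; congr _%:~R.
  rewrite [plane_val1 (f - g)](_ : _ = plane_val1 f - plane_val1 g) //.
  by rewrite [plane_val2 (f - g)](_ : _ = plane_val2 f - plane_val2 g) //; ring.
- move=> [a b]; have [a' <-] := Zp_intr_surj a; have [b' <-] := Zp_intr_surj b.
  have p2t : coprimez (p%:Z ^+ 2) (2 * t).
    by rewrite coprimezXl // coprimezMr !coprimez_prime // pt andbT dvdz2_odd.
  have [[u v] /= uv] := coprimezP _ _ p2t.
  have [f [fa fb fc _]] := split_dual a' (u * p * b') (v * b').
  exists f; rewrite /F fa fb fc; congr (_, _%:~R).
  transitivity ((u * p%:Z ^+ 2 + v * (2 * t)) * b'); first by ring.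
  by rewrite uv mul1r.
- move=> f; rewrite split_unit_embed //; split.
  + by move=> [/Zp_intr_eq0-/(_ d1) ? /Zp_intr_eq0-/(_ p1)].
  + by move=> [? ?]; congr (_, _); apply/Zp_intr_eq0.
Qed.

(** The generator is [- v0 / 2 d + w], where [w] takes the values [0] and [1] on
    the basis of the plane; its norm is [- 1 / 2 d + 2 t / p ^ 2]. *)
Lemma split_discr_cyclic : odd p -> ~~ (p %| t)%Z -> ~~ (p %| d)%N ->
  cyclic_discr M (2 * d * p ^ 2) (p%:Z ^+ 2 - 4 * d%:Z * t).
Proof.
move=> podd pt pd; have N1 : (1 < 2 * d * p ^ 2)%N.
  by have := prime_gt0 p_prime; rewrite -mulnA; nia.
have NE : (2 * d * p ^ 2)%N%:Z = 2 * d%:Z * p%:Z ^+ 2 by lia.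
have cp : coprimez (p%:Z ^+ 2) (2 * d%:Z).
  by rewrite coprimezXl // coprimezMr !coprimez_prime // dvdz2_odd.
pose F f : 'Z_(2 * d * p ^ 2) := (p%:Z ^+ 2 * fiber_val f +
  2 * d%:Z * (p%:Z * plane_val1 f + 2 * t * plane_val2 f))%:~R.
have [f [fa fb fc fX]] := split_dual 1 0 1.
have FB : zmod_morphism F.
  move=> g h; rewrite /F -intrB; congr _%:~R.
  rewrite [fiber_val (g - h)](_ : _ = fiber_val g - fiber_val h) //.
  rewrite [plane_val1 (g - h)](_ : _ = plane_val1 g - plane_val1 h) //.
  by rewrite [plane_val2 (g - h)](_ : _ = plane_val2 g - plane_val2 h) //; ring.
have [l Ffl] : exists l, F f *~ l = 1.
  have cN : coprimez (p%:Z ^+ 2 + 4 * d%:Z * t) (2 * d * p ^ 2)%N.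
    rewrite NE coprimezMr coprimezXr; last first.
      rewrite coprimez_sym coprimez_prime //.
      rewrite (@dvdz_congr _ _ (2 * (2 * d%:Z * t))); last first.
        by apply/dvdzP; exists p%:Z; ring.
      rewrite -coprimez_prime // !coprimezMr !coprimez_prime // pt andbT.
      by rewrite dvdz2_odd.
    have /coprimezP[[u v] /= uv] := cp; rewrite andbT.
    by apply/coprimezP; exists (u, v - 2 * t * u); rewrite -[RHS]uv /=; ring.
  have [[u v] /= uv] := coprimezP _ _ cN.
  exists u; apply/eqP; rewrite -subr_eq0; apply/eqP.
  have -> : F f *~ u - 1 = (F f *~ u - 1%:~R) by [].
  rewrite /F -mulrzA -intrB; apply/Zp_intr_eq0 => //; apply/dvdzP; exists (- v).
  by rewrite fa fb fc -[X in _ - X]uv; ring.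
(* The vector below is [2 d p ^ 2] times the functional [f]. *)
exists F, f, (2 * d * p ^ 2)%N%:Z,
  ((2 * d%:Z * p%:Z, 4 * d%:Z * t), (0, (- p%:Z ^+ 2, 0))); split.
- split=> //.
  + move=> a; have [b <-] := Zp_intr_surj a; exists (f *~ (l * b)).
    by rewrite (zmod_morphismMz _ _ FB) mulrzA Ffl.
  + move=> g; rewrite split_unit_embed //; rewrite Zp_intr_eq0 // NE.
    set w := p%:Z * _ + _; split=> [H|[/dvdzP[a ->] /dvdzP[b ->]]]; last first.
      by apply/dvdzP; exists (a + b); ring.
    split.
      rewrite -(@Gauss_dvdzr _ (p%:Z ^+ 2)) 1?coprimez_sym //.
      have /dvdzP[b bE] := H; apply/dvdzP; exists (b * p%:Z ^+ 2 - w).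
      by apply: (addIr (2 * d%:Z * w)); rewrite bE; ring.
    rewrite -(@Gauss_dvdzr _ (2 * d%:Z)) //.
    have /dvdzP[b bE] := H; apply/dvdzP; exists (b * (2 * d%:Z) - fiber_val g).
    by apply: (addrI (p%:Z ^+ 2 * fiber_val g)); rewrite bE; ring.
- by exists l.
- split; first by rewrite /=; case: (2 * d * p ^ 2)%N N1.
  move=> [[x y] [u [z e]]] /=.
  rewrite NE !osumE lattice1E lattice2E !lform0l /= fX; ring.
- rewrite !osumE lattice1E lattice2E !lform0l NE /=; ring.
Qed.
End SplitDiscriminant.

(** * Exponents of the discriminant groups *)

Lemma dvdNz (m n : int) : (- m %| n)%Z = (m %| n)%Z.
Proof. by rewrite !dvdzE abszN. Qed.

Lemma split_even (E : zlattice) (d p : nat) (t : int) :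
  even_lattice E -> even_lattice (split_lattice E d p t).
Proof.
move=> evE; apply: osum_even; first exact: (@lattice2_even (- t)).
apply: osum_even hplane_even _; apply: osum_even evE.
exact: (@lattice1_even (- d%:Z)).
Qed.

Lemma twisted_discr (E : zlattice) (d p : nat) :
  unimodular E -> (0 < d)%N -> (0 < p)%N ->
  group_iso (discr (twisted_lattice E d p)) 'Z_(2 * d * p ^ 2).
Proof.
move=> uE d0 p0; have N1 : (1 < 2 * d * p ^ 2)%N by rewrite -mulnA; nia.
pose F (f : dual_group (twisted_lattice E d p)) : 'Z_(2 * d * p ^ 2) :=
  (val f (0, (0, (1, 0))))%:~R.
apply: (@discr_model_iso _ _ F); split.
- by move=> f g; rewrite /F -intrB.
- move=> a; have [b <-] := Zp_intr_surj a.
  pose g (X : twisted_lattice E d p) : int := b * X.2.2.1.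
  have gB : zmod_morphism g.
    by move=> [u [v [z e]]] [u' [v' [z' e']]]; rewrite /g /=; ring.
  by exists (mkdual gB); rewrite /F /= /g /= mulr1.
- move=> f; rewrite Zp_intr_eq0 // embed_setP.
  have NE : (2 * d * p ^ 2)%N%:Z = 2 * d%:Z * p%:Z ^+ 2 by lia.
  have fB := dualB f; have f1B := zmod_morphism_inr fB.
  have f2B := zmod_morphism_inr f1B.
  rewrite representable_osum // representable_osum // representable_osum //.
  rewrite representable_lattice1; last exact: (zmod_morphism_inl f2B).
  rewrite mulrN mulNr -NE dvdNz.
  split=> [H|[_ [_ []]] //]; split.
    by apply: hplane_unimodular; apply: zmod_morphism_inl fB.
  split; first by apply: hplane_unimodular; apply: zmod_morphism_inl f1B.
  by split=> //; apply: uE; apply: zmod_morphism_inr f2B.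
Qed.

Lemma group_iso_exponent (A B : zmodType) (m : int) : group_iso A B ->
  (forall x : B, x *~ m = 0) -> forall x : A, x *~ m = 0.
Proof.
move=> [f [g fK gK]] B0 x; apply: (can_inj fK).
by rewrite raddfMz B0 raddf0.
Qed.

Lemma group_iso_sym (A B : zmodType) : group_iso A B -> group_iso B A.
Proof.
move=> [f [g fK gK]].
have gB : zmod_morphism g by move=> x y; apply: (can_inj fK); rewrite raddfB !gK.
pose G : {additive B -> A} := HB.pack g (GRing.isZmodMorphism.Build B A g gB).
by exists G, f.
Qed.

Lemma group_iso_trans (A B C : zmodType) :
  group_iso A B -> group_iso B C -> group_iso A C.
Proof.
move=> [f bf] [g bg].
by exists (g \o f : {additive A -> C}); apply: bij_comp.
Qed.

Lemma isometric_discr (M N : zlattice) :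
  isometric M N -> group_iso (discr M) (discr N).
Proof.
move=> /isometric_isom[g gi]; apply: group_iso_sym.
apply: (@discr_model_iso _ _ (@discr_class M \o pullback gi)).
apply: pullback_model; split.
- exact: discr_classB.
- by move=> a; have [f ->] := discr_class_surj a; exists f.
- move=> f.
  have e0 : discr_class (0 : dual_group M) = 0.
    by rewrite -(subrr 0) discr_classB subrr.
  by rewrite -e0 discr_classP subr0.
Qed.

Lemma Zp_intrMz (N : nat) (a : 'Z_N) (m : int) :
  (1 < N)%N -> (N %| m)%Z -> a *~ m = 0.
Proof.
move=> N1 Nm; have [b <-] := Zp_intr_surj a.
by rewrite -mulrzA; apply/Zp_intr_eq0 => //; apply: dvdz_mull.
Qed.

(** Together with the next two lemmas: the exponent [2 d p] separates the cyclic
    discriminant group from the others. *)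
Lemma cyclic_exponent (d p : nat) : (0 < d)%N -> (1 < p)%N ->
  ~ forall x : 'Z_(2 * d * p ^ 2), x *~ (2 * d * p)%N%:Z = 0.
Proof.
move=> d0 p1 H; have N1 : (1 < 2 * d * p ^ 2)%N by rewrite -mulnA; nia.
have /(Zp_intr_eq0 _ N1) := H 1; rewrite dvdzE /= => /dvdn_leq.
by rewrite -mulnn; nia.
Qed.

Lemma split_exponent (d p : nat) (x : 'Z_(2 * d) * 'Z_p * 'Z_p) :
  (0 < d)%N -> (1 < p)%N -> x *~ (2 * d * p)%N%:Z = 0.
Proof.
move=> d0 p1; have d1 : (1 < 2 * d)%N by lia.
case: x => [[a b] c]; rewrite !pairMz !Zp_intrMz //; rewrite dvdzE /=.
- exact: dvdn_mull.
- exact: dvdn_mull.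
- exact: dvdn_mulr.
Qed.

Lemma split_exponent2 (d p : nat) (x : 'Z_(2 * d) * 'Z_(p ^ 2)) :
  (0 < d)%N -> (1 < p)%N -> (p %| d)%N -> x *~ (2 * d * p)%N%:Z = 0.
Proof.
move=> d0 p1 pd; have d1 : (1 < 2 * d)%N by lia.
have p21 : (1 < p ^ 2)%N by rewrite -mulnn; nia.
case: x => [a b]; rewrite !pairMz !Zp_intrMz //; rewrite dvdzE /=.
- by rewrite -mulnn dvdn_mul // dvdn_mull.
- exact: dvdn_mulr.
Qed.

(** * The determinant of the form modulo p *)

Definition E8neg2 : zlattice := osum E8neg E8neg.

Lemma E8neg2_even : even_lattice E8neg2.
Proof. exact: osum_even E8neg_even E8neg_even. Qed.

Lemma E8neg2_unimodular : unimodular E8neg2.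
Proof. exact: osum_unimodular E8neg_unimodular E8neg_unimodular. Qed.

Section GramSums.

Lemma gram_form_dsum m n (A : 'M[int]_m) (B : 'M[int]_n) x1 x2 y1 y2 :
  gram_form (dsum A B) (row_mx x1 x2) (row_mx y1 y2) =
  gram_form A x1 y1 + gram_form B x2 y2.
Proof.
rewrite /gram_form /dsum mul_row_block tr_row_mx mul_row_col.
by rewrite !mulmx0 addr0 add0r mxE.
Qed.

Lemma gram_dsum_isom m n (A : 'M[int]_m) (B : 'M[int]_n) (sA : A^T = A)
    (sB : B^T = B) (sAB : (dsum A B)^T = dsum A B) :
  isom (fun x : gram_lattice sAB =>
    (lsubmx x, rsubmx x) : osum (gram_lattice sA) (gram_lattice sB)).
Proof.
split.
- by move=> x y; congr (_, _); rewrite /= linearB.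
- by exists (fun x => row_mx x.1 x.2) => [x|[x y]] /=;
    rewrite ?hsubmxK // row_mxKl row_mxKr.
- move=> x y; rewrite osumE -[in RHS](hsubmxK x) -[in RHS](hsubmxK y).
  by rewrite [RHS]gram_form_dsum.
Qed.

Lemma gram_scalar_isom (c : int) (sc : (c%:M : 'M[int]_1)^T = c%:M) :
  isom (fun x : gram_lattice sc => x 0 0 : lattice1 c).
Proof.
split.
- by move=> x y; rewrite !mxE.
- exists (fun z : int => z%:M) => [x|z]; first by rewrite [RHS]mx11_scalar.
  by rewrite mxE eqxx mulr1n.
- move=> x y; rewrite lattice1E /lform /= /gram_form mul_mx_scalar -scalemxAl.
  by rewrite mxE mxE big_ord1 !mxE.
Qed.

Lemma U_sym : U_mx^T = U_mx.
Proof. by apply/matrixP => i j; rewrite !mxE eq_sym. Qed.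

Lemma gram_U_isom (sU : U_mx^T = U_mx) :
  isom (fun x : gram_lattice sU => (x 0 0, x 0 1) : hplane).
Proof.
split.
- by move=> x y; congr (_, _); rewrite /= !mxE.
- exists (fun z : int * int => \row_j if j == 0 then z.1 else z.2) => [x|[a b]] /=.
    apply/rowP => -[[|[|//]] lj]; rewrite mxE /=; congr (x 0 _); exact: val_inj.
  by congr (_, _); rewrite mxE.
- move=> x y; rewrite hplaneE /= /lform /= /gram_form mxE !big_ord_recl big_ord0.
  have l1 : lift ord0 ord0 = 1 :> 'I_2 by apply: val_inj.
  by rewrite !mxE !big_ord_recl !big_ord0 !mxE !l1 /=; ring.
Qed.

Lemma gram_UE8_isom (s : (dsum U_mx (dsum E8neg_mx E8neg_mx))^T = _) :
  exists f : gram_lattice s -> osum hplane E8neg2, isom f.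
Proof.
have s2 := dsum_sym E8neg_sym E8neg_sym.
eexists; apply: isom_comp (gram_dsum_isom U_sym s2 s).
exact: isom_osum (gram_U_isom _) (gram_dsum_isom E8neg_sym E8neg_sym s2).
Qed.
End GramSums.

Lemma Fp_intr_eq0 (p : nat) (k : int) : prime p ->
  (k%:~R == 0 :> 'F_p) = (p %| k)%Z.
Proof. by move=> pp; rewrite -(dvdz_pcharf (pchar_Fp pp)). Qed.

Lemma gram_form_delta n (A : 'M[int]_n) i j :
  gram_form A (delta_mx 0 i) (delta_mx 0 j) = A i j.
Proof. by rewrite /gram_form -rowE trmx_delta -colE !mxE. Qed.

(** Only the values of [g] on the standard basis matter: if they are the rows of
    [P], then [A = P B P^T] modulo [p]. *)
Lemma det_congr_square (p n : nat) (A B : 'M[int]_n)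
    (g : 'rV[int]_n -> 'rV[int]_n) : prime p ->
  (forall x y, (p %| gram_form A x y - gram_form B (g x) (g y))%Z) ->
  exists m : int, (p %| \det A - m ^+ 2 * \det B)%Z.
Proof.
move=> pp gAB; pose P := \matrix_i g (delta_mx 0 i).
have rA : map_mx (intr : int -> 'F_p) A = map_mx intr (P *m B *m P^T).
  apply/matrixP => i j; rewrite [LHS]mxE [RHS]mxE; apply/eqP.
  rewrite -subr_eq0 -intrB Fp_intr_eq0 //.
  have := gAB (delta_mx 0 i) (delta_mx 0 j); rewrite gram_form_delta.
  congr (_ %| _ - _)%Z; rewrite /gram_form.
  have gE k : g (delta_mx 0 k) = delta_mx 0 k *m P by rewrite -rowE rowK.
  rewrite !gE trmx_mul !mulmxA trmx_delta -colE -!mulmxA -rowE !mxE.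
  by apply: eq_bigr => k _; rewrite !mxE.
exists (\det P); rewrite -Fp_intr_eq0 // intrB subr_eq0; apply/eqP.
by rewrite -det_map_mx [map_mx _ A]rA det_map_mx !det_mulmx det_tr; congr _%:~R; ring.
Qed.

Lemma det_dsum m n (A : 'M[int]_m) (B : 'M[int]_n) :
  \det (dsum A B) = \det A * \det B.
Proof. by rewrite /dsum det_ublock. Qed.

Section SplitNonIsometry.
Variables (d p : nat) (pd : (p %| d)%N) (p_prime : prime p) (p_odd : odd p).

Let rank19_mx (t : int) : 'M[int]_(1 + (2 + (8 + 8))) :=
  dsum ((2 * - t)%:M : 'M_1) (dsum U_mx (dsum E8neg_mx E8neg_mx)).

Let rank19_sym t : (rank19_mx t)^T = rank19_mx t.
Proof. by rewrite !dsum_sym ?tr_scalar_mx // ?U_sym // ?E8neg_sym. Qed.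

Let rank19_det : exists u v, u * v = 1 /\
  forall t, \det (rank19_mx t) = 2 * - t * u.
Proof.
pose D := \det (dsum U_mx (dsum E8neg_mx E8neg_mx)).
exists D, (- (\det E8neg_inv) ^+ 2); split; last first.
  by move=> t; rewrite /rank19_mx det_dsum det_scalar1.
have dE : \det E8neg_mx * \det E8neg_inv = 1.
  by rewrite -det_mulmx E8neg_mulV det1.
have dU : \det U_mx = - 1.
  by rewrite (expand_det_row _ ord0) !big_ord_recl big_ord0 /cofactor !det_mx11 !mxE.
rewrite /D !det_dsum dU.
transitivity ((\det E8neg_mx * \det E8neg_inv) ^+ 2); last by rewrite dE expr1n.
ring.
Qed.
Let rank19_isom t : exists f : gram_lattice (rank19_sym t) ->
  osum (lattice1 (2 * - t)) (osum hplane E8neg2), isom f.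
Proof.
have sK := dsum_sym U_sym (dsum_sym E8neg_sym E8neg_sym).
have sc := tr_scalar_mx 1 (2 * - t).
have [f fi] := gram_UE8_isom sK.
eexists; apply: isom_comp (gram_dsum_isom sc sK (rank19_sym t)).
exact: isom_osum (gram_scalar_isom sc) fi.
Qed.

(** As [p] divides [2 d], modulo [p] the form factors through a quotient
    of rank 19, of determinant [- 2 t] up to a unit. This determinant can be
    compared by restricting the isometry to a lift of the quotient and projecting
    its values. *)
Lemma split_isometric_square (t t' : int) :
  isometric (split_lattice E8neg2 d p t) (split_lattice E8neg2 d p t') ->
  exists m : int, (p %| t - m ^+ 2 * t')%Z.
Proof.
move=> /isometric_isom[f [fB _ ff]].
have [h [hB hbij hf]] := rank19_isom t.
have [h' /isom_inv[k' [[k'B _ k'f] _ h'K]]] := rank19_isom t'.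
pose i (X : osum (lattice1 (2 * - t)) (osum hplane E8neg2)) :
  split_lattice E8neg2 d p t := ((X.1, 0), (X.2.1, (0, X.2.2))).
pose j (X : split_lattice E8neg2 d p t') :
  osum (lattice1 (2 * - t')) (osum hplane E8neg2) :=
  (X.1.1, (X.2.1, X.2.2.2)).
have iE x y : lform (i x) (i y) = lform x y.
  by rewrite /i !osumE !lattice1E lattice2E /=; ring.
have jE x y : (p %| lform x y - lform (j x) (j y))%Z.
  have /dvdzP[q dq] : (p %| d%:Z)%Z by [].
  case: x y => [[x1 x2] [u [z e]]] [[y1 y2] [v [w e']]].
  rewrite /j !osumE !lattice1E lattice2E dq /=; apply/dvdzP.
  by exists (x1 * y2 + x2 * y1 - 2 * q * z * w); ring.
have [|m mP] := @det_congr_square p _ (rank19_mx t) (rank19_mx t')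
  (fun x => k' (j (f (i (h x))))) p_prime.
  move=> x y; rewrite -[gram_form _ x y]hf -iE -ff.
  by rewrite -[gram_form _ (k' _) _]/(lform (k' _) _) k'f.
have [u [v [uv detE]]] := rank19_det; exists m.
have p2 : coprimez p 2 by rewrite coprimez_prime // dvdz2_odd.
rewrite -(Gauss_dvdzr _ p2).
have -> : 2 * (t - m ^+ 2 * t') = - v *
  (\det (rank19_mx t) - m ^+ 2 * \det (rank19_mx t')).
  rewrite !detE; transitivity (u * v * (2 * (t - m ^+ 2 * t'))); last by ring.
  by rewrite uv mul1r.
exact: dvdz_mull.
Qed.
End SplitNonIsometry.

(** * Fibres and squares in finite fields *)

Local Close Scope classical_set_scope.
Local Open Scope set_scope.

(** The values of [f] live in any type, as they will be elements of a field or
    subgroups of a lattice. *)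
Lemma fiber_representatives (V : finType) (T : Type) (f : V -> T) (X : {set V})
    (k : nat) :
  (forall v, v \in X -> #|[set w in X | `[< f v = f w >]]| = k) ->
  exists R : {set V}, [/\ R \subset X, {in R &, injective f},
    forall v, v \in X -> exists2 r, r \in R & f r = f v & #|X| = (#|R| * k)%N].
Proof.
move=> fk; pose e : rel V := fun v w => `[< f v = f w >].
have eqe : {in X & &, equivalence_rel e}.
  move=> x y z _ _ _; split; first exact/asboolP.
  move=> /asboolP xy; rewrite /e xy; by [].
have partX := equivalence_partitionP eqe.
have trR := transversalP partX.
set P := equivalence_partition e X in partX trR.
set R := transversal P X in trR.
have RX : R \subset X := transversal_sub trR.
exists R; split=> //.
- move=> r s rR sR frs; apply: (pblock_inj trR) => //.
  have [rX sX] := (fintype.subsetP RX _ rR, fintype.subsetP RX _ sR).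
  apply/eqP; rewrite eq_pblock ?(finset.partition_trivIset partX) //.
    by rewrite pblock_equivalence_partition //; apply/asboolP.
  by rewrite (finset.cover_partition partX).
- move=> v vX.
  have vP : finset.pblock P v \in P by rewrite finset.pblock_mem // (finset.cover_partition partX).
  pose r := transversal_repr v R (finset.pblock P v).
  have rR : r \in R := repr_mem_transversal trR v vP.
  have rv := repr_mem_pblock trR v vP; exists r => //.
  by move: rv; rewrite pblock_equivalence_partition // ?(fintype.subsetP RX) // => /asboolP.
- rewrite (card_transversal trR); apply: card_uniform_partition partX.
  move=> B /imsetP[v vX ->]; rewrite -(fk v vX).
  by apply: eq_card => w; rewrite !inE.
Qed.

Section Squares.
Variable F : finFieldType.
Hypothesis F2 : 2%:R != 0 :> F.

Definition is_square (a : F) : bool := [exists x, a == x ^+ 2].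

Lemma is_squareP (a : F) : reflect (exists x, a = x ^+ 2) (is_square a).
Proof. by apply: (iffP existsP) => -[x /eqP]; exists x => //; apply/eqP. Qed.

Lemma neq_opp (x : F) : x != 0 -> x != - x.
Proof.
move=> x0; rewrite -subr_eq0 opprK -mulr2n -mulr_natr.
by rewrite mulf_neq0.
Qed.

Lemma square_roots (x : F) : [set y | y ^+ 2 == x ^+ 2] = [set x; - x].
Proof. by apply/finset.setP => y; rewrite !inE eqf_sqr. Qed.

Lemma card_square_roots (x : F) : x != 0 -> #|[set y | y ^+ 2 == x ^+ 2]| = 2%N.
Proof. by move=> x0; rewrite square_roots cards2 neq_opp. Qed.

Lemma card_nonzero_squares :
  (#|[set a : F | is_square a && (a != 0%R)]| * 2)%N = #|F|.-1.
Proof.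
have [v|R [RX Rinj Rsurj cX]] :=
    @fiber_representatives F F (fun x => x ^+ 2) [set x | x != 0] 2%N.
  rewrite inE => v0; rewrite -[RHS](card_square_roots v0); apply: eq_card => w.
  rewrite !inE; apply/andP/eqP => [[_ /asboolP]//|e]; split; last exact/asboolP.
  by rewrite -sqrf_eq0 e sqrf_eq0.
have -> : [set a | is_square a && (a != 0)] = [set x ^+ 2 | x in R].
  apply/finset.setP => a; rewrite inE; apply/andP/imsetP.
  - move=> [/is_squareP[x ->]]; rewrite sqrf_eq0 => x0.
    by have [|r rR e] := Rsurj x; rewrite ?inE //; exists r.
  - move=> [r rR ->]; split; first by apply/is_squareP; exists r.
    by have := fintype.subsetP RX _ rR; rewrite inE sqrf_eq0.
rewrite card_in_imset // -cX cardsE; have := cardC1 (0 : F).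
by rewrite -[RHS]/(#|F|.-1) => <-; apply: eq_card.
Qed.

Lemma card_squares : (#|[set a : F | is_square a]| * 2)%N = #|F|.+1.
Proof.
have -> : [set a : F | is_square a] =
    (0 : F) |: [set a : F | is_square a && (a != 0)].
  apply/finset.setP => a; rewrite !inE; case: eqP => [->|_]; last by rewrite andbT.
  by apply/is_squareP; exists (0 : F); rewrite expr0n.
rewrite cardsU1 inE eqxx andbF /=.
have aux (n s : nat) : (s * 2 = n.-1 -> 1 < n -> (1 + s) * 2 = n.+1)%N by lia.
exact: aux card_nonzero_squares (card_finNzRing_gt1 F).
Qed.

Lemma exists_nonsquare : exists a : F, ~~ is_square a.
Proof.
apply/existsP; rewrite -negb_forall; apply/negP => /forallP all_sq.
have : #|[set a : F | is_square a]| = #|F|.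
  by apply: eq_card => a; rewrite !inE all_sq.
have aux (n s : nat) : (s * 2 = n.+1 -> 1 < n -> s <> n)%N by lia.
exact: aux card_squares (card_finNzRing_gt1 F).
Qed.

(** The multiples of a nonsquare [a] by the nonzero squares are nonsquares, and
    there are as many of them as there are nonsquares. *)
Lemma nonsquare_div (a b : F) : ~~ is_square a -> ~~ is_square b ->
  exists2 c, c != 0 & b = a * c ^+ 2.
Proof.
move=> na nb.
have nz : forall x : F, ~~ is_square x -> x != 0.
  move=> x /is_squareP nx; apply/eqP => x0; apply: nx.
  by exists 0; rewrite x0 expr0n.
pose S := [set a : F | is_square a && (a != 0)].
pose T := [set a * x | x in S].
have cT : #|T| = #|S| by rewrite card_imset //; apply: mulfI; apply: nz.
have TN : T \subset [set x | ~~ is_square x].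
  apply/fintype.subsetP => u /imsetP[x]; rewrite !inE => /andP[/is_squareP[y xy]].
  rewrite xy sqrf_eq0 => y0 ->; apply: contra na => /is_squareP[z az].
  by apply/is_squareP; exists (z / y); rewrite expr_div_n -az mulfK // sqrf_eq0.
have : T = [set x | ~~ is_square x].
  apply/eqP; rewrite eqEcard TN cT /=.
  have := cardsC [set x : F | is_square x].
  have -> : ~: [set x : F | is_square x] = [set x | ~~ is_square x].
    by apply/finset.setP => x; rewrite !inE.
  have aux (n s s' u : nat) :
    (s * 2 = n.-1 -> s' * 2 = n.+1 -> s' + u = n -> u <= s)%N by lia.
  exact: aux card_nonzero_squares card_squares.
move=> /finset.setP/(_ b); rewrite inE nb => /imsetP[x].
rewrite inE => /andP[/is_squareP[c xc] x0] bx; exists c; last by rewrite bx xc.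
by rewrite -sqrf_eq0 -xc.
Qed.

(** More than half of the elements are squares, so the squares [x] meet the
    elements of the form [- 1 - x]. *)
Lemma sum_two_squares : exists a b : F, a ^+ 2 + b ^+ 2 = - 1.
Proof.
pose S := [set a : F | is_square a]; pose T := [set - 1 - x | x in S].
have cT : #|T| = #|S| by rewrite card_imset // => x y /addrI/oppr_inj.
have [x] : exists x, x \in S :&: T.
  apply/set0Pn; rewrite -card_gt0.
  have := cardsUI S T; rewrite cT.
  have aux (n s u i : nat) :
    (s * 2 = n.+1 -> u <= n -> u + i = s + s -> 0 < i)%N by lia.
  exact: aux card_squares (max_card (mem (S :|: T))).
rewrite inE => /andP[]; rewrite inE => /is_squareP[a xa] /imsetP[y].
rewrite inE => /is_squareP[b ->] e; exists a, b.
by rewrite -xa e subrK.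
Qed.
End Squares.

(** * Counting values of hyperbolic forms *)

Section HyperbolicCount.
Variable F : finFieldType.
Local Notation q := (#|F|%:Z).

(** These are the cardinals for a sum of [m.+1] hyperbolic planes. Only they are
    recorded, so that the notion is stable under any bijection of variables. *)
Definition hyperbolic_count (T : finType) (Q : T -> F) (m : nat) : Prop :=
  (#|T| = #|F| ^ (2 * m.+1))%N /\
  forall a, #|[set x | Q x == a]|%:Z =
    q ^+ (2 * m).+1 - q ^+ m + (a == 0)%:Z * q ^+ m.+1.

Lemma card_set_sum (T : finType) (P : pred T) : #|[set x | P x]| = (\sum_x P x)%N.
Proof.
rewrite cardsE -sum1_card big_mkcond; apply: eq_bigr => x _.
by rewrite unfold_in; case: (P x).
Qed.

(** A hyperbolic form takes all values equally often but for a surplus of the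
    value [0]; a sum [Q1 + Q2] inherits this. *)
Lemma count_add_hyperbolic (T1 T2 : finType) (Q1 : T1 -> F) (Q2 : T2 -> F)
    (m : nat) (a : F) : hyperbolic_count Q2 m ->
  #|[set z : T1 * T2 | Q1 z.1 + Q2 z.2 == a]|%:Z =
    #|T1|%:Z * (q ^+ (2 * m).+1 - q ^+ m) +
    #|[set x | Q1 x == a]|%:Z * q ^+ m.+1.
Proof.
move=> [_ Q2m].
have -> : #|[set z : T1 * T2 | Q1 z.1 + Q2 z.2 == a]| =
    (\sum_x #|[set y | Q2 y == (a - Q1 x)%R]|)%N.
  rewrite card_set_sum -(pair_bigA _ (fun x y => nat_of_bool (Q1 x + Q2 y == a))) /=.
  apply: eq_bigr => x _; rewrite card_set_sum; apply: eq_bigr => y _.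
  by rewrite [in RHS]eq_sym subr_eq addrC [in RHS]eq_sym.
rewrite card_set_sum !(big_morph Posz PoszD (erefl (Posz 0))).
rewrite mulr_suml -[X in X * _]mulr1 -mulrA.
have -> : #|T1|%:Z * (1 * (q ^+ (2 * m).+1 - q ^+ m)) =
    \sum_(x : T1) (q ^+ (2 * m).+1 - q ^+ m).
  by rewrite sumr_const mul1r -mulr_natl natz.
rewrite -big_split; apply: eq_bigr => x _ /=.
by rewrite Q2m subr_eq0 [a == _]eq_sym.
Qed.

Lemma hyperbolic_count_add (T1 T2 : finType) (Q1 : T1 -> F) (Q2 : T2 -> F)
    (m n : nat) : hyperbolic_count Q1 m -> hyperbolic_count Q2 n ->
  hyperbolic_count (fun z : T1 * T2 => Q1 z.1 + Q2 z.2) (m + n).+1.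
Proof.
move=> h1 h2; have [c1 N1] := h1; have [c2 _] := h2; split.
  by rewrite card_prod c1 c2 -expnD; congr (_ ^ _)%N; lia.
move=> a; rewrite (count_add_hyperbolic _ _ h2) N1 c1.
rewrite -[(_ ^ _)%N%:Z]natz natrX natz.
have -> : ((2 * m.+1) = m + m + 2)%N by lia.
have -> : ((2 * (m + n).+1).+1 = m + m + n + n + 3)%N by lia.
have -> : ((2 * m).+1 = m + m + 1)%N by lia.
have -> : ((2 * n).+1 = n + n + 1)%N by lia.
by rewrite !exprS !exprD; ring.
Qed.

Lemma hyperbolic_count_bij (T T' : finType) (Q : T -> F) (Q' : T' -> F)
    (g : T' -> T) (m : nat) : bijective g -> (forall x, Q' x = Q (g x)) ->
  hyperbolic_count Q m -> hyperbolic_count Q' m.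
Proof.
move=> gbij QQ' [cT Qm]; split; first by rewrite (bij_eq_card gbij).
move=> a; rewrite -Qm; congr Posz.
rewrite -(on_card_preimset (onW_bij _ gbij)).
by apply: eq_card => x; rewrite !inE QQ'.
Qed.

Lemma hyperbolic_count_scale (T : finType) (Q : T -> F) (c : F) (m : nat) :
  c != 0 -> hyperbolic_count Q m -> hyperbolic_count (fun x => c * Q x) m.
Proof.
move=> c0 [cT Qm]; split=> // a.
have -> : (a == 0) = (c^-1 * a == 0) by rewrite mulf_eq0 invr_eq0 (negPf c0).
rewrite -Qm; congr Posz; apply: eq_card => x; rewrite !inE.
by rewrite -[RHS](inj_eq (mulfI c0)) mulrA mulfV // mul1r.
Qed.

(** The product [x y] takes the value [a] once for every nonzero [x]. *)
Lemma hyperbolic_count_plane :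
  hyperbolic_count (fun x : F * F => x.1 * x.2) 0.
Proof.
split; first by rewrite card_prod mulnn.
move=> a; rewrite card_set_sum -(pair_bigA _ (fun x y => nat_of_bool (x * y == a))) /=.
rewrite (bigD1 (0 : F)) //=.
have -> : (\sum_(y : F) (0 * y == a)%R = (a == 0)%R * #|F|)%N.
  under eq_bigr => y _ do rewrite mul0r eq_sym.
  by rewrite sum_nat_const mulnC.
have -> : (\sum_(x : F | x != 0%R) \sum_y (x * y == a)%R = #|F|.-1)%N.
  rewrite -(cardC1 (0 : F)) -sum1_card; apply: eq_bigr => x x0.
  rewrite (bigD1 (a / x)) //= mulrC divfK // eqxx big1 // => y.
  move=> ya; apply/eqP; rewrite eqb0; apply: contra ya => /eqP <-.
  by rewrite mulrAC mulfV // mul1r.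
have := card_finNzRing_gt1 F; move: #|F| => n n1.
rewrite PoszD PoszM muln0 !expr1 expr0.
have -> : n.-1%:Z = n%:Z - 1 by lia.
ring.
Qed.

(** With [u ^+ 2 + v ^+ 2 = - 1], the last two squares become the opposite of a
    sum of two squares, and [x ^+ 2 - y ^+ 2] is a hyperbolic plane. *)
Lemma hyperbolic_count_squares : 2%:R != 0 :> F ->
  hyperbolic_count (fun x : (F * F) * (F * F) =>
    x.1.1 ^+ 2 + x.1.2 ^+ 2 + (x.2.1 ^+ 2 + x.2.2 ^+ 2)) 1.
Proof.
move=> F2; have [u [v uv]] := sum_two_squares F2.
have h2 := hyperbolic_count_add hyperbolic_count_plane hyperbolic_count_plane.
pose g (x : (F * F) * (F * F)) :=
  let y := u * x.2.1 - v * x.2.2 in let z := v * x.2.1 + u * x.2.2 in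
  ((x.1.1 - y, x.1.1 + y), (x.1.2 - z, x.1.2 + z)).
apply: (@hyperbolic_count_bij _ _ _ _ g) h2; last first.
- move=> [[a b] [c d]]; rewrite /g /=.
  transitivity (a ^+ 2 + b ^+ 2 - (u ^+ 2 + v ^+ 2) * (c ^+ 2 + d ^+ 2)).
    by rewrite uv; ring.
  by ring.
- apply: injF_bij => -[[a b] [c d]] [[a' b'] [c' d']] [e1 e2 e3 e4].
  have half (x x' y y' : F) : x - y = x' - y' -> x + y = x' + y' ->
      x = x' /\ y = y'.
    move=> f1 f2; have xx : x = x'.
      apply: (mulIf F2); rewrite !mulr_natr !mulr2n.
      transitivity ((x - y) + (x + y)); first by ring.
      by rewrite f1 f2; ring.
    by split=> //; apply: (@addrI _ x'); rewrite -{1}xx.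
  have [-> y1] := half _ _ _ _ e1 e2; have [-> y2] := half _ _ _ _ e3 e4.
  have uvE (w : F) : w = - (u ^+ 2 + v ^+ 2) * w by rewrite uv opprK mul1r.
  congr (_, (_, _)).
    rewrite (uvE c) (uvE c').
    transitivity (- (u * (u * c - v * d) + v * (v * c + u * d))); first by ring.
    by rewrite y1 y2; ring.
  rewrite (uvE d) (uvE d').
  transitivity (- (u * (v * c + u * d) - v * (u * c - v * d))); first by ring.
  by rewrite y1 y2; ring.
Qed.
End HyperbolicCount.

(** * The form of Lambda' over a finite field *)

Section QuadraticForms.
Variable F : finFieldType.
Hypothesis F2 : 2%:R != 0 :> F.

Definition gram_quad n (A : 'M[int]_n) (x : 'rV[F]_n) : F :=
  (x *m map_mx intr A *m x^T) 0 0.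

Lemma gram_quad_U : hyperbolic_count (gram_quad U_mx) 0.
Proof.
have h := hyperbolic_count_scale F2 (hyperbolic_count_plane F).
apply: (@hyperbolic_count_bij _ _ _ _ _ (fun x : 'rV[F]_2 => (x 0 0, x 0 1))) h.
- exists (fun z : F * F => \row_j if j == 0 then z.1 else z.2) => [x|[a b]] /=.
    apply/rowP => -[[|[|//]] lj]; rewrite mxE /=; congr (x 0 _); exact: val_inj.
  by congr (_, _); rewrite mxE.
- move=> x; rewrite /gram_quad mxE !big_ord_recl big_ord0.
  have l1 : lift ord0 ord0 = 1 :> 'I_2 by apply: val_inj.
  by rewrite !mxE !big_ord_recl !big_ord0 !mxE !l1 /=; ring.
Qed.

Lemma gram_quad_dsum a b (A : 'M[int]_a) (B : 'M[int]_b) m n :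
  hyperbolic_count (gram_quad A) m -> hyperbolic_count (gram_quad B) n ->
  hyperbolic_count (gram_quad (dsum A B)) (m + n).+1.
Proof.
move=> hA hB; have h := hyperbolic_count_add hA hB.
apply: (@hyperbolic_count_bij _ _ _ _ _
  (fun x : 'rV[F]_(a + b) => (lsubmx x, rsubmx x))) h.
- by exists (fun z => row_mx z.1 z.2) => [x|[x y]] /=;
    rewrite ?hsubmxK // row_mxKl row_mxKr.
- move=> x; rewrite -{1}[x]hsubmxK /gram_quad /dsum map_block_mx !map_mx0.
  rewrite mul_row_block tr_row_mx mul_row_col !mulmx0 addr0 add0r.
  by rewrite mxE.
Qed.

Lemma mx_sum8 (x : 'rV[F]_8) : (x *m x^T) 0 0 =
  (x 0 (inord 0%N) ^+ 2 + x 0 (inord 1%N) ^+ 2 +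
   (x 0 (inord 2%N) ^+ 2 + x 0 (inord 3%N) ^+ 2)) +
  (x 0 (inord 4%N) ^+ 2 + x 0 (inord 5%N) ^+ 2 +
   (x 0 (inord 6%N) ^+ 2 + x 0 (inord 7%N) ^+ 2)).
Proof.
rewrite mxE (eq_bigr (fun i : 'I_8 => x 0 (inord i) ^+ 2)); last first.
  by move=> i _; rewrite inord_val mxE expr2.
by rewrite !big_ord_recl big_ord0 /= !addrA addr0.
Qed.

(** In the coordinates of [E8_roots] the form is a sum of eight squares up to a
    constant, and the change of coordinates is invertible over [F] because
    the lattice is unimodular. *)
Lemma gram_quad_E8 : hyperbolic_count (gram_quad E8neg_mx) 3.
Proof.
have h4 := hyperbolic_count_squares F2.
have h8 := hyperbolic_count_add h4 h4.
have c0 : - (2%:R * 2%:R)^-1 != 0 :> F by rewrite oppr_eq0 invr_eq0 mulf_neq0.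
have {h4}h8 := hyperbolic_count_scale c0 h8.
pose B : 'M[F]_8 := map_mx intr E8_roots.
pose coord (x : 'rV[F]_8) : ((F * F) * (F * F)) * ((F * F) * (F * F)) :=
  (((x 0 (inord 0%N), x 0 (inord 1%N)), (x 0 (inord 2%N), x 0 (inord 3%N))),
   ((x 0 (inord 4%N), x 0 (inord 5%N)), (x 0 (inord 6%N), x 0 (inord 7%N)))).
have BB : B *m B^T = (- (2%:R * 2%:R)) *: map_mx intr E8neg_mx.
  rewrite /B map_trmx -map_mxM E8_roots_gram map_mxZ; congr (_ *: _).
  by rewrite rmorphN rmorph_nat -natrM.
have coordK : bijective coord.
  exists (fun z : ((F * F) * (F * F)) * ((F * F) * (F * F)) => \row_j
    nth 0 [:: z.1.1.1; z.1.1.2; z.1.2.1; z.1.2.2;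
              z.2.1.1; z.2.1.2; z.2.2.1; z.2.2.2] j) => [x|].
    apply/rowP => j; rewrite mxE -[in RHS](inord_val j) /coord /=.
    by case: j => [] [|[|[|[|[|[|[|[|//]]]]]]]] ?.
  move=> [[[a b] [c d]] [[e f] [g i]]] /=.
  by rewrite /coord !mxE !inordK.
have Binj : bijective (fun x : 'rV[F]_8 => x *m B).
  have [Bu _] : B \in unitmx /\ B^T *m (- (2%:R * 2%:R)^-1 *:
      map_mx intr E8neg_inv) \in unitmx.
    apply: mulmx1_unit; rewrite mulmxA BB -scalemxAr -scalemxAl -map_mxM.
    rewrite E8neg_mulV map_mx1 scalerA mulNr mulrN opprK mulVf ?mulf_neq0 //.
    by rewrite scale1r.
  by exists (fun y => y *m invmx B) => x; rewrite ?mulmxK ?mulmxKV.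
apply: (@hyperbolic_count_bij _ _ _ _ _ (fun x => coord (x *m B))) h8.
  exact: bij_comp coordK Binj.
move=> x; rewrite /coord /= -mx_sum8 trmx_mul mulmxA -(mulmxA x) BB.
rewrite -scalemxAr -scalemxAl mxE mulrA mulNr mulrN opprK mulVf ?mulf_neq0 //.
by rewrite mul1r.
Qed.

Lemma gram_quad_Lambda' : hyperbolic_count (gram_quad Lambda'_mx) 9.
Proof.
have hU := gram_quad_U; have hE := gram_quad_E8.
exact: gram_quad_dsum hU (gram_quad_dsum hU (gram_quad_dsum hE hE)).
Qed.
End QuadraticForms.

(** * Cardinals of images and classes of isometric sublattices *)

Local Open Scope classical_set_scope.

Lemma card_range_ord (T : Type) (n : nat) (f : 'I_n -> T) :
  injective f -> range f #= `I_n.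
Proof.
move=> fI; apply: (card_eq_trans (inj_card_eq _)).
  by move=> x y _ _; apply: fI.
by rewrite card_eq_sym; apply: card_II.
Qed.

Lemma card_image_fibers (V : finType) (T : Type) (f : V -> T) (X : {set V})
    (k n : nat) : (0 < k)%N ->
  (forall v, v \in X -> #|[set w in X | `[< f v = f w >]]%SET| = k) ->
  #|X| = (n * k)%N ->
  [set f v | v in [set v | v \in X]] #= `I_n.
Proof.
move=> k0 fk cX; have [R [RX Rinj Rsurj cR]] := fiber_representatives fk.
have -> : n = #|R| by apply/eqP; rewrite -(eqn_pmul2r k0) -cX cR.
have -> : [set f v | v in [set v | v \in X]] =
    range (fun i : 'I_#|R| => f (enum_val i)).
  apply/seteqP; split=> [_ [v /= vX <-]|_ [i _ <-]].
  - have [r rR <-] := Rsurj v vX.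
    by exists (enum_rank_in rR r) => //; rewrite enum_rankK_in.
  - exists (enum_val i) => //=.
    by apply: (fintype.subsetP RX); apply: enum_valP.
apply: card_range_ord => i j /Rinj; rewrite !enum_valP => /(_ isT isT).
exact: enum_val_inj.
Qed.

(** Two members of [Gam] are isometric exactly when they are modelled on the same
    [N j]. *)
Lemma isometry_classes_range (M : zlattice) (Gam : set (subgroup M)) (n : nat)
    (S : 'I_n -> set (subgroup M)) (N : 'I_n -> zlattice) :
  (forall G, Gam G <-> exists j, S j G) ->
  (forall j G, S j G -> isometric (N j) (sublattice G)) ->
  (forall i j, isometric (N i) (N j) -> i = j) ->
  (forall j, S j !=set0) ->
  isometry_classes Gam = range S /\ isometry_classes Gam #= `I_n.
Proof.
move=> GamS NS NI S0.
have classE j G : S j G -> isometry_class Gam G = S j.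
  move=> SG; apply/seteqP; split=> G' /=.
  - move=> [/GamS[i SG'] GG'].
    suff -> : j = i by [].
    apply: NI; apply: isometric_trans (NS _ _ SG) _.
    exact: isometric_trans GG' (isometric_sym (NS _ _ SG')).
  - move=> SG'; split; first by apply/GamS; exists j.
    exact: isometric_trans (isometric_sym (NS _ _ SG)) (NS _ _ SG').
have classes : isometry_classes Gam = range S.
  apply/seteqP; split=> [_ [G /GamS[j SG] <-]|_ [j _ <-]].
  - by exists j => //; rewrite (classE _ _ SG).
  - have [G SG] := S0 j; exists G; last exact: classE.
    by apply/GamS; exists j.
split=> //; rewrite classes; apply: card_range_ord => i j Sij.
have [G SG] := S0 i; apply: NI; apply: isometric_trans (NS _ _ SG) _.
by apply: isometric_sym; apply: NS; rewrite -Sij.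
Qed.

Lemma subgroup_ext (V : zmodType) (G H : subgroup V) :
  (forall x, sg_set G x <-> sg_set H x) -> G = H.
Proof.
case: G H => [G G0 GB] [H H0 HB] /= GH.
have e : G = H by apply/funext => x; apply/propext.
subst H; congr Subgroup; exact: Prop_irrelevance.
Qed.

Lemma card_nonempty (T : Type) (A : set T) (n : nat) :
  (0 < n)%N -> A #= `I_n -> A !=set0.
Proof.
move=> n0 cA; apply/set0P/eqP => A0; move: cA; rewrite A0 card_eq_sym card_eq0.
by move=> /eqP I0; have : `I_n 0%N by []; rewrite I0.
Qed.

(** * Functionals modulo p and their kernels *)

Lemma dsum_mulV m n (A A' : 'M[int]_m) (B B' : 'M[int]_n) :
  A *m A' = 1%:M -> B *m B' = 1%:M -> dsum A B *m dsum A' B' = 1%:M.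
Proof.
move=> AA BB; rewrite /dsum mulmx_block !mulmx0 !mul0mx !addr0 !add0r AA BB.
by rewrite -scalar_mx_block.
Qed.

Lemma Lambda'_mulV :
  exists B : 'M[int]_(2 + (2 + (8 + 8))), Lambda'_mx *m B = 1%:M.
Proof.
have UU : U_mx *m U_mx = 1%:M.
  apply/matrixP => i j; rewrite !mxE !big_ord_recl big_ord0 !mxE.
  by case: i => [] [|[|//]] ?; case: j => [] [|[|//]] ?.
exists (dsum U_mx (dsum U_mx (dsum E8neg_inv E8neg_inv))).
by do 2!apply: dsum_mulV => //; apply: dsum_mulV; apply: E8neg_mulV.
Qed.

Section Functionals.
Variables (d : nat) (F : finFieldType).
Hypothesis intr_surj : forall a : F, exists k : int, k%:~R = a.
Local Notation rk := (2 + (2 + (8 + 8)))%N.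
Local Notation coeffs := (F * 'rV[F]_rk)%type.

Definition functional (v : coeffs) (X : v0Lambda' d) : F :=
  (lsubmx (X : 'rV_(1 + rk)) 0 0)%:~R * v.1 +
  (v.2 *m map_mx intr Lambda'_mx *m (map_mx intr (rsubmx (X : 'rV_(1 + rk))))^T) 0 0.

Lemma functionalB v : zmod_morphism (functional v).
Proof.
move=> X Y; rewrite /functional !linearB /= map_mxB linearB /= mulmxBr.
by rewrite !mxE intrB; ring.
Qed.

Lemma functional_v0_add v z (l : Lambda') : functional v (v0_add d z l) =
  z%:~R * v.1 + (v.2 *m map_mx intr Lambda'_mx *m (map_mx intr l)^T) 0 0.
Proof. by rewrite /functional row_mxKl row_mxKr mxE eqxx mulr1n. Qed.

Lemma v0_add_surj (X : v0Lambda' d) : exists z l, X = v0_add d z l.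
Proof.
exists (lsubmx (X : 'rV_(1 + rk)) 0 0), (rsubmx (X : 'rV_(1 + rk))).
by rewrite /v0_add -mx11_scalar hsubmxK.
Qed.

Lemma v0_addD z l z' l' :
  v0_add d (z + z') (l + l') = v0_add d z l + v0_add d z' l'.
Proof. by rewrite /v0_add raddfD /= -add_row_mx. Qed.

Lemma Lambda'_F_unit : (map_mx intr Lambda'_mx : 'M[F]_rk) \in unitmx.
Proof.
have [B AB] := Lambda'_mulV.
have e : (map_mx intr Lambda'_mx : 'M[F]_rk) *m map_mx intr B = 1%:M.
  by rewrite -map_mxM AB map_mx1.
by have [] := mulmx1_unit e.
Qed.

(** The form of [Lambda'] stays nondegenerate modulo [p], so that every functional
    on [Lambda'] is the product with some vector modulo [p]. *)
Lemma functional_complete (f : v0Lambda' d -> F) :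
  zmod_morphism f -> exists v, forall X, f X = functional v X.
Proof.
move=> fB.
pose c := \row_j f (v0_add d 0 (delta_mx 0 j)).
exists (f (v0_add d 1 0), c *m invmx (map_mx intr Lambda'_mx)) => X.
have [z [l ->]] := v0_add_surj X.
rewrite functional_v0_add /= mulmxKV ?Lambda'_F_unit //.
have -> : v0_add d z l = v0_add d z 0 + v0_add d 0 l.
  by rewrite -v0_addD addr0 add0r.
rewrite (zmod_morphismD _ _ fB); congr (_ + _).
  have fzB : zmod_morphism (fun z => f (v0_add d z 0)).
    move=> a b; rewrite -fB; congr f.
    by rewrite /v0_add raddfB /= opp_row_mx add_row_mx subr0.
  rewrite -{1}[z]intz (zmod_morphismMz _ _ fzB) mulrzl //.
have flB : zmod_morphism (fun l : 'rV[int]_rk => f (v0_add d 0 l)).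
  move=> a b; rewrite -fB; congr f.
  by rewrite /v0_add opp_row_mx add_row_mx raddf0 subr0.
rewrite (zmod_morphism_row _ flB) mxE; apply: eq_bigr => j _.
by rewrite !mxE mulrzr.
Qed.

Lemma functional_inj v w :
  (forall X, functional v X = functional w X) -> v = w.
Proof.
move=> vw; have v1 : v.1 = w.1.
  have := vw (v0_add d 1 0); rewrite !functional_v0_add.
  by rewrite map_mx0 trmx0 !mulmx0 !mxE !addr0 !mul1r.
have v2 : v.2 *m map_mx intr Lambda'_mx = w.2 *m map_mx intr Lambda'_mx.
  apply/rowP => j; have := vw (v0_add d 0 (delta_mx 0 j)).
  rewrite !functional_v0_add !mul0r !add0r map_delta_mx trmx_delta.
  by rewrite -!colE !mxE.
have v2' := can_inj (mulmxK Lambda'_F_unit) v2.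
by case: v w v1 v2' {vw v2} => [? ?] [? ?] /= -> ->.
Qed.

Definition scale_coeffs (c : F) (v : coeffs) : coeffs := (c * v.1, c *: v.2).

Lemma functional_scale c v X :
  functional (scale_coeffs c v) X = c * functional v X.
Proof.
rewrite /functional /= -!scalemxAl [X in _ + X]mxE mulrDr; congr (_ + _).
exact: mulrCA.
Qed.

Lemma functional0 X : functional (0, 0) X = 0.
Proof. by rewrite /functional /= mulr0 !mul0mx mxE addr0. Qed.

Lemma functional_surj v : v != (0, 0) -> forall a, exists X, functional v X = a.
Proof.
move=> v0 a.
have [X vX] : exists X, functional v X != 0.
  apply: contrapT => H; case/eqP: v0; apply: functional_inj => X.
  rewrite functional0; apply/eqP; apply: contrapT => /negP vX.
  by apply: H; exists X.
have [k ka] : exists k : int, k%:~R = a / functional v X.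
  exact: intr_surj.
exists (X *~ k).
by rewrite (zmod_morphismMz _ _ (functionalB v)) -mulrzl ka divfK.
Qed.

(** Take a vector where [v] has the value [1]: any other vector differs from
    a multiple of it by an element of the common kernel. *)
Lemma functional_kernel v w : v != (0, 0) -> w != (0, 0) ->
  (forall X, functional v X = 0 <-> functional w X = 0) ->
  exists2 c, c != 0 & w = scale_coeffs c v.
Proof.
move=> v0 w0 vw; have [X0 vX0] := functional_surj v0 1.
have wE : w = scale_coeffs (functional w X0) v.
  apply: functional_inj => X; rewrite functional_scale.
  have [k ka] : exists k : int, k%:~R = functional v X.
    exact: intr_surj.
  have : functional v (X - X0 *~ k) = 0.
    rewrite functionalB (zmod_morphismMz _ _ (functionalB v)) vX0.
    by rewrite -ka subrr.
  move=> /vw; rewrite functionalB (zmod_morphismMz _ _ (functionalB w)).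
  by move=> /subr0_eq->; rewrite -mulrzr ka.
exists (functional w X0) => //; apply: contraNneq w0 => c0.
by rewrite wE c0 /scale_coeffs mul0r scale0r.
Qed.
End Functionals.

(** * Kernels are isometric to normal forms *)

Lemma Lambda'_isom : exists f : Lambda' -> osum hplane (osum hplane E8neg2), isom f.
Proof.
have sK := dsum_sym U_sym (dsum_sym E8neg_sym E8neg_sym).
have [f fi] := gram_UE8_isom sK.
eexists; apply: isom_comp (gram_dsum_isom U_sym sK Lambda'_sym).
exact: isom_osum (gram_U_isom U_sym) fi.
Qed.

(** The generator [v0] is moved next to the last summand, to let the two
    hyperbolic planes come first. *)
Lemma fiber_last_isom (d : nat) (E : zlattice) :
  isom (fun Y : osum (lattice1 (- (2 * d%:Z))) (osum hplane (osum hplane E)) =>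
    (Y.2.1, (Y.2.2.1, (Y.1, Y.2.2.2))) :
    osum hplane (osum hplane (osum (lattice1 (2 * - d%:Z)) E))).
Proof.
split=> //.
- by exists (fun X => (X.2.2.1, (X.1, (X.2.1, X.2.2.2)))) => [[z [u [v e]]]|[u [v [z e]]]].
- move=> [z [u [v e]]] [z' [u' [v' e']]].
  by rewrite !osumE !lattice1E /=; ring.
Qed.

Lemma v0Lambda'_isom (d : nat) (f : Lambda' -> osum hplane (osum hplane E8neg2)) :
  isom f -> exists2 g : v0Lambda' d ->
    osum hplane (osum hplane (osum (lattice1 (2 * - d%:Z)) E8neg2)), isom g
    & forall z l, g (v0_add d z l) = ((f l).1, ((f l).2.1, (z, (f l).2.2))).
Proof.
move=> fi; have sc := tr_scalar_mx 1 (- (2 * d%:Z)).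
eexists.
  apply: isom_comp (fiber_last_isom d E8neg2) _.
  apply: isom_comp (isom_osum (gram_scalar_isom sc) fi) _.
  exact: gram_dsum_isom sc Lambda'_sym (v0Lambda'_sym d).
move=> z l /=; rewrite /v0_add row_mxKl row_mxKr mxE eqxx mulr1n.
by [].
Qed.

Section KernelLattices.
Variables (d p : nat) (M : zlattice) (phi : v0Lambda' d -> M) (psi : M -> v0Lambda' d).
Hypotheses (p_prime : prime p) (phi_isom : isom phi) (psi_isom : isom psi).
Hypotheses (phiK : cancel phi psi) (psiK : cancel psi phi).
Local Notation rk := (2 + (2 + (8 + 8)))%N.
Local Notation coeffs := ('F_p * 'rV['F_p]_rk)%type.
Implicit Types v : coeffs.

Lemma Fp_intr_surj (a : 'F_p) : exists k : int, k%:~R = a.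
Proof. by exists (a : nat)%:Z; rewrite -pmulrn natr_Zp. Qed.

Lemma kernel_lattice0 v : functional v (psi 0) = 0.
Proof.
have [psiB _ _] := psi_isom.
by rewrite -(subrr 0) psiB functionalB subrr.
Qed.

Lemma kernel_latticeB v (x y : M) : functional v (psi x) = 0 ->
  functional v (psi y) = 0 -> functional v (psi (x - y)) = 0.
Proof.
have [psiB _ _] := psi_isom.
by move=> vx vy; rewrite psiB functionalB vx vy subrr.
Qed.

Definition kernel_lattice v : subgroup M :=
  @Subgroup M [set x | functional v (psi x) = 0]
    (kernel_lattice0 v) (@kernel_latticeB v).

Lemma row_lift n (x : 'rV['F_p]_n) : exists l : 'rV[int]_n, map_mx intr l = x.
Proof.
exists (\row_j (x 0 j : nat)%:Z); apply/rowP => j.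
by rewrite !mxE -pmulrn natr_Zp.
Qed.

Lemma gram_form_intr (l l' : Lambda') : (lform l l')%:~R =
  (map_mx intr l *m map_mx intr Lambda'_mx *m (map_mx intr l')^T) 0 0 :> 'F_p.
Proof.
rewrite -[lform l l']/((l *m Lambda'_mx *m l'^T) 0 0) map_trmx -!map_mxM.
by rewrite [RHS]mxE.
Qed.

Lemma functional_lift v (l0 : Lambda') z (l : Lambda') : map_mx intr l0 = v.2 ->
  functional v (v0_add d z l) = z%:~R * v.1 + (lform l0 l)%:~R.
Proof. by move=> l0v; rewrite functional_v0_add gram_form_intr l0v. Qed.

Lemma realizes_kernel_lattice (N L : zlattice) (g : v0Lambda' d -> L) v
    (P : L -> Prop) :
  isom g -> realizes N P -> (forall X, functional v X = 0 <-> P (g X)) ->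
  isometric N (sublattice (kernel_lattice v)).
Proof.
move=> gi NP vP; apply: realizes_sublattice.
have [g' [g'i gK g'K]] := isom_inv gi.
apply: (realizes_isom (isom_comp phi_isom g'i) _ NP) => y /=.
by rewrite phiK vP g'K.
Qed.

(** The first congruence makes [v] the product with the vector [i v0 + lambda], and
    the second one says that this vector has norm [2 t] modulo [p]. *)
Lemma kernel_lattice_split v (i t : int) : odd p -> v != (0, 0) ->
  (2 * - d%:Z * i)%:~R = v.1 ->
  gram_quad Lambda'_mx v.2 + (2 * - d%:Z * i ^+ 2)%:~R = (2 * t)%:~R ->
  isometric (split_lattice E8neg2 d p t) (sublattice (kernel_lattice v)).
Proof.
move=> podd v0 iv tv; have [f fi] := Lambda'_isom.
have [g gi gE] := v0Lambda'_isom d fi; have [_ _ ff] := fi.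
have [l0 l0v] : exists l0 : Lambda', map_mx intr l0 = v.2 := row_lift v.2.
pose Lam : osum hplane (osum hplane (osum (lattice1 (2 * - d%:Z)) E8neg2)) :=
  ((f l0).1, ((f l0).2.1, (i, (f l0).2.2))).
have LamE z l : lform Lam (g (v0_add d z l)) =
    lform l0 l + 2 * - d%:Z * (i * z).
  by rewrite gE -(ff l0 l) !osumE lattice1E /=; ring.
have vLam X : functional v X = (lform Lam (g X))%:~R.
  have [z [l ->]] := v0_add_surj X.
  by rewrite (functional_lift _ _ l0v) LamE -iv intrD !intrM; ring.
have LL : (p %| lform Lam Lam - 2 * t)%Z.
  have -> : lform Lam Lam = lform l0 l0 + 2 * - d%:Z * i ^+ 2.
    by rewrite -(ff l0 l0) !osumE lattice1E /=; ring.
  rewrite -Fp_intr_eq0 // intrB subr_eq0 -tv intrD gram_form_intr l0v.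
  by rewrite /gram_quad.
have [X vX] := functional_surj d Fp_intr_surj v0 1.
have LX : ~~ (p %| lform Lam (g X))%Z.
  by rewrite -Fp_intr_eq0 // -vLam vX oner_eq0.
have evK : even_lattice (osum (lattice1 (2 * - d%:Z)) E8neg2).
  exact: osum_even (@lattice1_even _) E8neg2_even.
apply: realizes_kernel_lattice gi (realizes_vector p_prime podd evK LX LL) _.
by move=> Y; rewrite vLam -Fp_intr_eq0 //; split=> /eqP.
Qed.

Lemma kernel_lattice_twisted v : (p %| d)%N -> v.1 = 1 ->
  isometric (twisted_lattice E8neg2 d p) (sublattice (kernel_lattice v)).
Proof.
move=> pd v1; have [f fi] := Lambda'_isom.
have [g gi gE] := v0Lambda'_isom d fi; have [_ _ ff] := fi.
have [l0 l0v] : exists l0 : Lambda', map_mx intr l0 = v.2 := row_lift v.2.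
have pd' : (p %| - d%:Z)%Z by rewrite rpredN.
have := realizes_twisted (prime_gt0 p_prime) pd' E8neg2_even
  (f l0).1.2 (f l0).1.1 ((f l0).2.1, (f l0).2.2).
move=> H; apply: (realizes_kernel_lattice gi H) => X.
have [z [l ->]] := v0_add_surj X.
rewrite (functional_lift _ _ l0v) v1 mulr1 -intrD.
have -> : z + lform l0 l = twisted (n := - d%:Z) (f l0).1.2 (f l0).1.1
  ((f l0).2.1, (f l0).2.2) (g (v0_add d z l)).
  rewrite -(ff l0 l) gE /twisted !osumE !hplaneE /=; ring.
by rewrite -Fp_intr_eq0 //; split=> /eqP.
Qed.
End KernelLattices.

(** * Kernels in the transcendental lattice *)

Section KernelFamilies.
Variables (d p : nat) (h : H2) (phi : {additive v0Lambda' d -> T_S h}).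
Variable psi : T_S h -> v0Lambda' d.
Hypotheses (p_prime : prime p) (p_odd : odd p).
Hypotheses (phi_isom : isom phi) (psi_isom : isom psi).
Hypotheses (phiK : cancel phi psi) (psiK : cancel psi phi).
Local Notation rk := (2 + (2 + (8 + 8)))%N.
Local Notation coeffs := ('F_p * 'rV['F_p]_rk)%type.
Local Notation ker_lat := (@kernel_lattice d p (T_S h) psi psi_isom).
Implicit Types v w : coeffs.

Lemma kernel_lattice_eq v w : v != (0, 0) -> w != (0, 0) ->
  ker_lat v = ker_lat w <-> exists2 c, c != 0 & w = scale_coeffs c v.
Proof.
move=> v0 w0; split=> [vw|[c c0 ->]].
- apply: (functional_kernel (@Fp_intr_surj p) v0 w0) => X.
  have : sg_set (ker_lat v) (phi X) <-> sg_set (ker_lat w) (phi X) by rewrite vw.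
  by rewrite /= phiK.
- apply: subgroup_ext => x /=; rewrite functional_scale; split=> [->|].
    by rewrite mulr0.
  by move=> /eqP; rewrite mulf_eq0 (negPf c0) => /eqP.
Qed.

Lemma functional_Br v : v != (0, 0) -> exists alpha : Br h p,
  [/\ forall a, exists x, alpha x = a, ker_lat v = kernel alpha
    & forall X, alpha (phi X) = functional v X].
Proof.
move=> v0; have [psiB _ _] := psi_isom.
have aB : zmod_morphism (fun x => functional v (psi x)).
  by move=> x y; rewrite psiB functionalB.
pose alpha : {additive T_S h -> 'F_p} := HB.pack (fun x => functional v (psi x))
  (GRing.isZmodMorphism.Build _ _ _ aB).
have alphaE X : alpha (phi X) = functional v X by rewrite /alpha /= phiK.
exists alpha; split=> //; last exact: subgroup_ext.
move=> a; have [X <-] := functional_surj d (@Fp_intr_surj p) v0 a.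
by exists (phi X).
Qed.

Lemma kernel_functional (alpha : Br h p) v :
  (forall a, exists x, alpha x = a) ->
  (forall X, alpha (phi X) = functional v X) ->
  v != (0, 0) /\ kernel alpha = ker_lat v.
Proof.
move=> alphaS vE; split.
  apply/eqP => v0; have [x] := alphaS 1.
  rewrite -[x]psiK vE v0 functional0 => /esym/eqP; exact/negP/oner_neq0.
by apply: subgroup_ext => x /=; rewrite -vE psiK.
Qed.

Lemma Gammas_kernel (G : subgroup (T_S h)) :
  Gammas p G <-> exists2 v, v != (0, 0) & G = ker_lat v.
Proof.
split=> [[alpha alphaS ->]|[v /functional_Br[alpha [alphaS -> _]] ->]].
- have aB : zmod_morphism (fun X => alpha (phi X)).
    by move=> X Y; rewrite !raddfB.
  have [v vE] := functional_complete aB; exists v.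
    exact: (kernel_functional alphaS vE).1.
  exact: (kernel_functional alphaS vE).2.
- by exists alpha.
Qed.

Lemma has_invariants_kernel (G : subgroup (T_S h)) (i : nat) (c : int) :
  has_invariants p phi G i c <-> exists v,
    [/\ v != (0, 0), v.1 = i%:R, G = ker_lat v
      & exists2 l : Lambda', map_mx intr l = v.2 & lform l l = - (2 * c)].
Proof.
split.
- move=> [alpha [l [alphaS -> alphaE lc]]].
  pose v : coeffs := (i%:R, map_mx intr l).
  have vE X : alpha (phi X) = functional v X.
    have [z [l' ->]] := v0_add_surj X.
    rewrite alphaE (@functional_lift _ _ v l) // intrD intrM.
    by rewrite -pmulrn.
  have [v0 kerE] := kernel_functional alphaS vE.
  by exists v; split=> //; exists l.
- move=> [v [v0 vi -> [l lv lc]]].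
  have [alpha [alphaS kerE vE]] := functional_Br v0.
  exists alpha, l; split=> // z l'.
  by rewrite vE (functional_lift _ _ _ lv) vi intrD intrM -pmulrn.
Qed.

Definition kernel_family (X : {set coeffs}) : set (subgroup (T_S h)) :=
  [set ker_lat v | v in [set v | v \in X]].

(** Subgroups of this form correspond to lines of functionals, so it suffices to
    count how often [X] meets the lines it meets. *)
Lemma card_kernel_family (X : {set coeffs}) (k n : nat) :
  (0 < k)%N -> (forall v, v \in X -> v != (0, 0)) ->
  (forall v, v \in X ->
    #|[set c : 'F_p | (c != 0) && (scale_coeffs c v \in X)]%SET| = k) ->
  #|X| = (n * k)%N ->
  kernel_family X #= `I_n.
Proof.
move=> k0 X0 Xk cX; apply: card_image_fibers k0 _ cX => v vX.
have v0 := X0 v vX; rewrite -(Xk v vX).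
rewrite -(card_in_imset (f := fun c : 'F_p => scale_coeffs c v)).
  apply: eq_card => w; rewrite !inE; apply/andP/imsetP.
  - move=> [wX /asboolP/(kernel_lattice_eq v0 (X0 w wX))[c c0 wE]].
    by exists c; rewrite // inE c0 -wE.
  - move=> [c]; rewrite inE => /andP[c0 cvX] ->; split=> //.
    by apply/asboolP/(kernel_lattice_eq v0 (X0 _ cvX)); exists c.
move=> c c' _ _ cc'; have [X1 vX1] := functional_surj d (@Fp_intr_surj p) v0 1.
by have := functional_scale c v X1; rewrite cc' functional_scale vX1 !mulr1.
Qed.
End KernelFamilies.

(** * Number of functionals with a given invariant *)

Lemma Posz_exp (m n : nat) : (m ^ n)%N%:Z = m%:Z ^+ n.
Proof. by rewrite -[LHS]natz natrX natz. Qed.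

Section Counts.
Variables (d p : nat).
Hypotheses (p_prime : prime p) (p_odd : odd p).
Local Notation rk := (2 + (2 + (8 + 8)))%N.
Local Notation coeffs := ('F_p * 'rV['F_p]_rk)%type.
Local Notation quad := (@gram_quad 'F_p rk Lambda'_mx).
Implicit Types v w : coeffs.

Lemma Fp_2neq0 : 2%:R != 0 :> 'F_p.
Proof.
by have := dvdz2_odd p_prime p_odd; rewrite -Fp_intr_eq0.
Qed.

Lemma card_quad (a : 'F_p) : #|[set x | quad x == a]%SET|%:Z =
  p%:Z ^+ 19 - p%:Z ^+ 9 + (a == 0)%:Z * p%:Z ^+ 10.
Proof.
have [_ H] := gram_quad_Lambda' (F := 'F_p) Fp_2neq0.
by rewrite H card_Fp.
Qed.

(** The invariant [i ^ 2 - 2 d lambda ^ 2], that is, [i ^ 2 + 4 d c]. *)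
Definition kernel_disc v : 'F_p := v.1 ^+ 2 + (2 * - d%:Z)%:~R * quad v.2.

Lemma quadZ c x : quad (c *: x) = c ^+ 2 * quad x.
Proof. by rewrite /gram_quad linearZ -!scalemxAl -scalemxAr !mxE expr2 mulrA. Qed.

Lemma kernel_disc_scale c v : kernel_disc (scale_coeffs c v) = c ^+ 2 * kernel_disc v.
Proof. by rewrite /kernel_disc /= quadZ; ring. Qed.

Lemma card_kernel_disc (a : 'F_p) : ~~ (p %| d)%N ->
  #|[set v | kernel_disc v == a]%SET|%:Z =
    p%:Z ^+ 20 - p%:Z ^+ 10 + #|[set x : 'F_p | x ^+ 2 == a]%SET|%:Z * p%:Z ^+ 10.
Proof.
move=> pd; have c0 : (2 * - d%:Z)%:~R != 0 :> 'F_p.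
  rewrite Fp_intr_eq0 // mulrN rpredN -coprimez_prime // coprimezMr.
  by rewrite !coprimez_prime // dvdz2_odd.
have hyp := hyperbolic_count_scale c0 (gram_quad_Lambda' (F := 'F_p) Fp_2neq0).
rewrite (count_add_hyperbolic (fun x : 'F_p => x ^+ 2) a hyp) card_Fp //.
by rewrite mulrBr -!exprS.
Qed.

Lemma card_sign (r : 'F_p) : r != 0 ->
  #|[set c : 'F_p | (c != 0) && (c ^+ 2 * r == r)]%SET| = 2%N.
Proof.
move=> r0; rewrite -[RHS](card_square_roots Fp_2neq0 (oner_neq0 _)).
apply: eq_card => c; rewrite !inE expr1n -{2}[r]mul1r (inj_eq (mulIf r0)).
by rewrite andb_idl // => /eqP c2; rewrite -sqrf_eq0 c2 oner_neq0.
Qed.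

Lemma card_square_level a n : ~~ (p %| d)%N -> a != 0 ->
  #|[set x : 'F_p | x ^+ 2 == a]%SET| = n ->
  #|[set v | kernel_disc v == a]%SET| = (p ^ 10 * (p ^ 10 + n) - p ^ 10)%N.
Proof.
move=> pd a0 cn; apply/eqP; rewrite -eqz_nat card_kernel_disc // cn -subzn.
  by rewrite PoszM PoszD !Posz_exp; apply/eqP; ring.
by rewrite leq_pmulr // ltn_addr // expn_gt0 prime_gt0.
Qed.

Lemma card_isotropic_lines : ~~ (p %| d)%N ->
  #|[set v | (v != (0, 0)) && (kernel_disc v == 0)]%SET| = (p ^ 20 - 1)%N.
Proof.
move=> pd; apply/eqP.
have -> : [set v | (v != (0, 0)) && (kernel_disc v == 0)]%SET =
    ([set v | kernel_disc v == 0] :\ (0, 0))%SET.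
  by apply/finset.setP => v; rewrite !inE.
have v0 : (0, 0) \in [set v | kernel_disc v == 0]%SET.
  by rewrite inE /kernel_disc /gram_quad /= !mul0mx mxE expr0n mulr0 addr0.
have := cardsD1 (0, 0) [set v | kernel_disc v == 0]%SET; rewrite v0 => cD.
have c0 : #|[set x : 'F_p | x ^+ 2 == 0]%SET| = 1%N.
  by rewrite -[RHS](cards1 (0 : 'F_p)); apply: eq_card => x; rewrite !inE sqrf_eq0.
have : #|[set v | kernel_disc v == 0]%SET| = (p ^ 20)%N.
  apply/eqP; rewrite -eqz_nat card_kernel_disc // c0 Posz_exp; apply/eqP; ring.
rewrite cD => <-; apply/eqP; by rewrite add1n subn1.
Qed.

Lemma card_slice (i : 'F_p) (S : {set 'rV['F_p]_rk}) :
  #|finset.setX [set i] S| = #|S|.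
Proof. by rewrite cardsX cards1 mul1n. Qed.

Lemma card_quad_level a : a != 0 ->
  #|[set x | quad x == a]%SET| = (p ^ 9 * (p ^ 10 - 1))%N.
Proof.
move=> a0; apply/eqP; rewrite -eqz_nat card_quad (negPf a0) /= mul0r addr0 PoszM -subzn.
  by rewrite !Posz_exp; apply/eqP; ring.
by rewrite expn_gt0 prime_gt0.
Qed.

Lemma card_quad_isotropic :
  #|([set x | quad x == 0] :\ 0)%SET| = ((p ^ 9 + 1) * (p ^ 10 - 1))%N.
Proof.
have x0 : 0 \in [set x | quad x == 0]%SET.
  by rewrite inE /gram_quad !mul0mx mxE.
have := cardsD1 0 [set x | quad x == 0]%SET; rewrite x0 => cD.
have := card_quad 0; rewrite cD eqxx PoszD /= mul1r => e.
apply/eqP; rewrite -eqz_nat -(inj_eq (addrI 1)) {}e PoszM -subzn.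
  by rewrite PoszD !Posz_exp; apply/eqP; ring.
by rewrite expn_gt0 prime_gt0.
Qed.
End Counts.

(** * Discriminant types of the normal forms *)

Lemma isometric_even (M N : zlattice) :
  isometric M N -> even_lattice M -> even_lattice N.
Proof.
move=> /isometric_isom[f [_ [g _ fK] ff]] evM y.
by have [k kE] := evM (g y); exists k; rewrite -[y]fK ff.
Qed.

Lemma Lambda'_even : even_lattice Lambda'.
Proof.
have [f fi] := Lambda'_isom.
apply: isometric_even (isometric_sym (isom_isometric fi)) _.
exact: osum_even hplane_even (osum_even hplane_even E8neg2_even).
Qed.

Lemma square_modP (p : nat) (k : int) : prime p ->
  square_mod p k <-> is_square (k%:~R : 'F_p).
Proof.
move=> pp; split.
- move=> [m /eqP]; rewrite eqz_mod_dvd -Fp_intr_eq0 // intrB subr_eq0 => /eqP->.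
  by apply/is_squareP; exists m%:~R; rewrite rmorphXn.
- move=> /is_squareP[x kx]; have [m mx] := Fp_intr_surj x; exists m.
  by apply/eqP; rewrite eqz_mod_dvd -Fp_intr_eq0 // intrB kx -mx rmorphXn subrr.
Qed.

Lemma is_squareM (F : finFieldType) (c a : F) : c != 0 ->
  is_square (c ^+ 2 * a) = is_square a.
Proof.
move=> c0; apply/is_squareP/is_squareP => -[x xE].
- by exists (x / c); rewrite expr_div_n -xE mulrAC mulfV ?mul1r // sqrf_eq0.
- by exists (c * x); rewrite xE exprMn.
Qed.

Section DiscriminantTypes.
Variables (d p : nat).
Hypotheses (d_gt0 : (0 < d)%N) (p_prime : prime p) (p_odd : odd p).
Local Notation N := (2 * d * p ^ 2)%N.

Definition cyclic_type (b : bool) (M : zlattice) : Prop :=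
  group_iso (discr M) 'Z_N /\ exists (v : discr M) (k : int),
    [/\ generates v, represents (- N%:Z) v k & is_square (k%:~R : 'F_p) = b].

Definition noncyclic_type (M : zlattice) : Prop :=
  group_iso (discr M) ('Z_(2 * d) * 'Z_p * 'Z_p)%type.

Lemma cyclic_noncyclic (A : zmodType) (m : int) (B C : zmodType) :
  group_iso A B -> group_iso A C -> (forall x : C, x *~ m = 0) ->
  forall x : B, x *~ m = 0.
Proof.
move=> AB AC C0; apply: group_iso_exponent C0.
exact: group_iso_trans (group_iso_sym AB) AC.
Qed.

(** For the generator of [split_discr_cyclic] the value is [p ^ 2 - 4 d t], and
    the multiplier between two generators is a unit modulo [p]. *)
Lemma split_cyclic_type (t : int) (M : zlattice) :
  ~~ (p %| t)%Z -> ~~ (p %| d)%N -> isometric (split_lattice E8neg2 d p t) M ->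
  (forall b, cyclic_type b M <-> is_square ((- (4 * d%:Z * t))%:~R : 'F_p) = b) /\
  ~ noncyclic_type M.
Proof.
move=> pt pd iM; have p1 := prime_gt1 p_prime.
have N1 : (1 < N)%N by rewrite -mulnA; nia.
have cM := cyclic_discr_isometric iM
  (split_discr_cyclic E8neg2_unimodular d_gt0 p_prime p_odd pt pd).
have evM := isometric_even iM (@split_even _ d p t E8neg2_even).
have [isoN [v [genv repv]] reps] := cyclic_discrP N1 evM cM.
have pF : (p%:Z%:~R : 'F_p) = 0 by apply/eqP; rewrite Fp_intr_eq0.
have kE : ((p%:Z ^+ 2 - 4 * d%:Z * t)%:~R : 'F_p) = (- (4 * d%:Z * t))%:~R.
  by rewrite intrB rmorphXn /= pF expr0n sub0r intrN.
split; last first.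
  move=> /(cyclic_noncyclic isoN) H; apply: (cyclic_exponent d_gt0 p1); apply: H.
  by move=> x; apply: split_exponent.
move=> b; split=> [[_ [v' [k' [genv' repv' <-]]]]|<-]; last first.
  by split=> //; exists v, (p%:Z ^+ 2 - 4 * d%:Z * t); rewrite kE.
have [m [m' [j [Nmm ->]]]] := reps v' k' genv' repv'.
have NF : (N%:Z%:~R : 'F_p) = 0.
  by apply/eqP; rewrite Fp_intr_eq0 // dvdzE /= dvdn_mull // dvdn_exp.
have m0 : (m%:~R : 'F_p) != 0.
  apply/eqP => m0; move: Nmm => /dvdzP[u mu].
  have := congr1 (fun x : int => x%:~R : 'F_p) mu.
  rewrite intrB !intrM m0 NF mul0r mulr0 sub0r => /eqP; rewrite oppr_eq0.
  by rewrite oner_eq0.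
rewrite intrD [X in _ + X]intrM NF mul0r addr0 [X in _ = is_square X]intrM kE.
by rewrite rmorphXn /= is_squareM.
Qed.

Lemma split_noncyclic_type (M : zlattice) :
  isometric (split_lattice E8neg2 d p 0) M ->
  noncyclic_type M /\ forall b, ~ cyclic_type b M.
Proof.
move=> iM; have p1 := prime_gt1 p_prime.
have iC : noncyclic_type M.
  apply: group_iso_trans (group_iso_sym (isometric_discr iM)) _.
  exact: split_discr_isotropic E8neg2_unimodular d_gt0 p_prime _.
split=> // b [isoN _]; apply: (cyclic_exponent d_gt0 p1).
apply: (cyclic_noncyclic isoN iC) => x.
exact: split_exponent.
Qed.
End DiscriminantTypes.

Lemma range_ord3 (T : Type) (f : 'I_3 -> T) :
  range f = [set f (inord 0); f (inord 1); f (inord 2)].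
Proof.
apply/seteqP; split=> [_ [j _ <-]|x /= [[]|] ->]; [|by eexists..].
rewrite -(inord_val j); case: j => -[|[|[|//]]] lj /=; by [left; left|left; right|right].
Qed.

Lemma range_ord4 (T : Type) (f : 'I_4 -> T) :
  range f = [set f (inord 0); f (inord 1); f (inord 2); f (inord 3)].
Proof.
apply/seteqP; split=> [_ [j _ <-]|x /= [[[]|]|] ->]; [|by eexists..].
rewrite -(inord_val j); case: j => -[|[|[|[|//]]]] lj /=;
  by [left; left; left|left; left; right|left; right|right].
Qed.

(** * The classification *)

Section Classification.
Variables (d p : nat) (h : H2) (phi : {additive v0Lambda' d -> T_S h}).
Variable psi : T_S h -> v0Lambda' d.
Hypotheses (d_gt0 : (0 < d)%N) (p_prime : prime p) (p_odd : odd p).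
Hypotheses (phi_isom : isom phi) (psi_isom : isom psi).
Hypotheses (phiK : cancel phi psi) (psiK : cancel psi phi).
Local Notation rk := (2 + (2 + (8 + 8)))%N.
Local Notation coeffs := ('F_p * 'rV['F_p]_rk)%type.
Local Notation ker_lat := (@kernel_lattice d p (T_S h) psi psi_isom).
Local Notation quad := (@gram_quad 'F_p rk Lambda'_mx).
Local Notation N := (2 * d * p ^ 2)%N.
Local Notation kernel_family := (@kernel_family d p h psi psi_isom).
Implicit Types (v w : coeffs) (G : subgroup (T_S h)).

Lemma ker_lat_scale c v : v != (0, 0) -> c != 0 ->
  ker_lat (scale_coeffs c v) = ker_lat v.
Proof.
move=> v0 c0; apply: subgroup_ext => x /=; rewrite functional_scale.
by split=> [/eqP|->]; rewrite ?mulr0 // mulf_eq0 (negPf c0) => /eqP.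
Qed.

Lemma scale_coeffs_neq0 c v : v != (0, 0) -> c != 0 ->
  scale_coeffs c v != (0, 0).
Proof.
move=> v0 c0; apply: contra v0 => /eqP e.
have /eqP : c * v.1 = 0 := congr1 fst e; have /eqP : c *: v.2 = 0 := congr1 snd e.
rewrite mulf_eq0 scaler_eq0 (negPf c0) /=.
by case: v {e} => a b /= /eqP-> /eqP->.
Qed.

Section CoprimeCase.
Hypothesis pd : ~~ (p %| d)%N.

Definition disc_family (r : 'F_p) : {set coeffs} :=
  [set v | (v != (0, 0)) && (kernel_disc d v == r)]%SET.

Lemma scale_disc_family c v r : v \in disc_family r -> c != 0 ->
  (scale_coeffs c v \in disc_family r) = (c ^+ 2 * r == r).
Proof.
rewrite !inE => /andP[v0 /eqP vr] c0.
by rewrite scale_coeffs_neq0 // kernel_disc_scale vr.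
Qed.

Lemma disc_familyE r : r != 0 -> disc_family r = [set v | kernel_disc d v == r]%SET.
Proof.
move=> r0; apply/finset.setP => v; rewrite !inE andb_idl // => /eqP vr.
apply: contraNneq r0 => v0.
by rewrite -vr v0 /kernel_disc /gram_quad /= !mul0mx mxE expr0n mulr0 addr0.
Qed.

Lemma card_disc_family r n m : r != 0 ->
  #|[set x : 'F_p | x ^+ 2 == r]%SET| = n ->
  (m * 2 = p ^ 10 * (p ^ 10 + n) - p ^ 10)%N ->
  kernel_family (disc_family r) #= `I_m.
Proof.
move=> r0 cn mE; apply: (@card_kernel_family _ _ _ _ _ psi_isom phiK _ 2).
- by [].
- by move=> v; rewrite inE => /andP[].
- move=> v vX; rewrite -[RHS](card_sign p_prime p_odd r0); apply: eq_card => c.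
  by rewrite inE [RHS]inE; apply: andb_id2l => c0; apply: scale_disc_family.
- by rewrite disc_familyE // (card_square_level p_prime p_odd pd r0 cn) mE.
Qed.

Lemma card_isotropic_family :
  kernel_family (disc_family 0) #= `I_((p ^ 20 - 1) %/ (p - 1)).
Proof.
have p1 := prime_gt1 p_prime.
apply: (@card_kernel_family _ _ _ _ _ psi_isom phiK _ (p - 1)).
- by rewrite subn_gt0.
- by move=> v; rewrite inE => /andP[].
- move=> v vX; have := cardC1 (0 : 'F_p); rewrite card_Fp // subn1 => <-.
  apply: eq_card => c; rewrite !inE; apply/andP/idP => [[]//|c0]; split=> //.
  by have := scale_disc_family vX c0; rewrite inE mulr0 eqxx.
- rewrite card_isotropic_lines // divnK //.
  by rewrite !subn1 -(exp1n 20) dvdn_pred_predX.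
Qed.

(** With [2 d i' = - i] modulo [p], the functional is the product with
    [i' v0 + lambda], whose norm is the invariant divided by [- 2 d]. *)
Lemma disc_family_split (r : 'F_p) (t : int) G :
  (- (4 * d%:Z * t))%:~R = r -> kernel_family (disc_family r) G ->
  isometric (split_lattice E8neg2 d p t) (sublattice G).
Proof.
move=> tr [v /=]; rewrite inE => /andP[v0 /eqP vr] <-.
have c0 : (2 * - d%:Z)%:~R != 0 :> 'F_p.
  rewrite Fp_intr_eq0 // mulrN rpredN -coprimez_prime // coprimezMr.
  by rewrite !coprimez_prime // dvdz2_odd.
have [i iE] := Fp_intr_surj (v.1 / (2 * - d%:Z)%:~R).
have i1 : (2 * - d%:Z * i)%:~R = v.1 by rewrite intrM iE mulrC divfK.
apply: (kernel_lattice_split p_prime phi_isom psi_isom phiK p_odd v0 i1).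
apply: (mulfI c0); rewrite mulrDr -intrM.
have -> : 2 * - d%:Z * (2 * - d%:Z * i ^+ 2) = (2 * - d%:Z * i) ^+ 2 by ring.
rewrite rmorphXn /= i1 addrC -[LHS]/(kernel_disc d v) vr -tr -intrM.
by congr _%:~R; ring.
Qed.

(** Scaling a functional changes its invariant by a square, so the nonzero
    invariants can be normalized to [1] and to a fixed nonsquare. *)
Lemma Gammas_disc_family (eta : 'F_p) G : ~~ is_square eta ->
  Gammas p G <-> [\/ kernel_family (disc_family 1) G,
    kernel_family (disc_family eta) G | kernel_family (disc_family 0) G].
Proof.
move=> eta_ns; rewrite (Gammas_kernel p psi_isom phiK psiK); split; last first.
  by case=> -[v /=]; rewrite inE => /andP[v0 _] <-; exists v.
move=> [v v0 ->].
have scaled c r : c != 0 -> kernel_disc d v = c ^+ 2 * r ->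
    kernel_family (disc_family r) (ker_lat v).
  move=> c0 vr; exists (scale_coeffs c^-1 v).
    rewrite /= inE scale_coeffs_neq0 ?invr_eq0 // kernel_disc_scale vr.
    by rewrite exprVn mulKf ?eqxx ?sqrf_eq0.
  by rewrite ker_lat_scale // invr_eq0.
have [Q0|Q0] := eqVneq (kernel_disc d v) 0.
  by apply: Or33; apply: (scaled 1); rewrite ?oner_neq0 ?mulr0.
have [/is_squareP[c cE]|Qns] := boolP (is_square (kernel_disc d v)).
  apply: Or31; apply: (scaled c); last by rewrite mulr1.
  by rewrite -sqrf_eq0 -cE.
have [c c0 cE] := nonsquare_div (Fp_2neq0 p_prime p_odd) eta_ns Qns.
by apply: Or32; apply: (scaled c); rewrite // mulrC.
Qed.

Definition class_family (eta : 'F_p) (j : nat) : set (subgroup (T_S h)) :=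
  kernel_family (disc_family (nth 0 [:: 1; eta; 0] j)).

Definition class_type (j : nat) (M : zlattice) : Prop :=
  match j with
  | 0 => cyclic_type d p true M
  | 1 => cyclic_type d p false M
  | _ => noncyclic_type d p M
  end.

Lemma disc_lift (r : 'F_p) : exists t : int, (- (4 * d%:Z * t))%:~R = r.
Proof.
have c0 : (- (4 * d%:Z))%:~R != 0 :> 'F_p.
  have -> : 4 * d%:Z = 2 * (2 * d%:Z) by ring.
  rewrite Fp_intr_eq0 // rpredN -coprimez_prime // !coprimezMr.
  by rewrite !coprimez_prime // dvdz2_odd.
have [t tE] := Fp_intr_surj (r / (- (4 * d%:Z))%:~R).
by exists t; rewrite -mulNr intrM tE mulrC divfK.
Qed.

Lemma class_typing (eta : 'F_p) : ~~ is_square eta -> exists L : nat -> zlattice,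
  (forall j G, (j < 3)%N -> class_family eta j G ->
    isometric (L j) (sublattice G)) /\
  forall i j M, (i < 3)%N -> (j < 3)%N -> isometric (L j) M ->
    class_type i M <-> i = j.
Proof.
move=> eta_ns; have [t0 t0E] := disc_lift 1; have [t1 t1E] := disc_lift eta.
exists (fun j => split_lattice E8neg2 d p (nth 0 [:: t0; t1; 0] j)); split.
  move=> j G j3; apply: disc_family_split.
  by case: j j3 => [|[|[|//]]] _ //=; rewrite mulr0 oppr0.
have one_sq : is_square (1 : 'F_p).
  by apply/is_squareP; exists 1; rewrite expr1n.
have eta0 : eta != 0.
  by apply: contraNneq eta_ns => ->; apply/is_squareP; exists 0; rewrite expr0n.
have unit_lift (t : int) (r : 'F_p) :
    (- (4 * d%:Z * t))%:~R = r -> r != 0 -> ~~ (p %| t)%Z.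
  move=> <-; apply: contra; rewrite Fp_intr_eq0 // rpredN; exact: dvdz_mull.
have pt0 := unit_lift _ _ t0E (oner_neq0 _).
have pt1 := unit_lift _ _ t1E eta0.
move=> i [|[|[|//]]] M i3 _ /= iM.
- have [ct nct] := split_cyclic_type d_gt0 p_prime p_odd pt0 pd iM.
  by case: i i3 => [|[|[|//]]] _ /=; rewrite ?ct ?t0E ?one_sq.
- have [ct nct] := split_cyclic_type d_gt0 p_prime p_odd pt1 pd iM.
  by case: i i3 => [|[|[|//]]] _ /=; rewrite ?ct ?t1E ?(negPf eta_ns).
- have [nct ct] := split_noncyclic_type d_gt0 p_prime iM.
  by case: i i3 => [|[|[|//]]] _ /=; split=> // /ct.
Qed.

Lemma classification_coprime :
  let A := [set G | Gammas p G /\ group_iso (discr (sublattice G)) 'Z_N /\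
    exists (v : discr (sublattice G)) (k : int),
      [/\ generates v, represents (- N%:Z) v k & square_mod p k]] in
  let B := [set G | Gammas p G /\ group_iso (discr (sublattice G)) 'Z_N /\
    exists (v : discr (sublattice G)) (k : int),
      [/\ generates v, represents (- N%:Z) v k & ~ square_mod p k]] in
  let C := [set G | Gammas p G /\
    group_iso (discr (sublattice G)) ('Z_(2 * d) * 'Z_p * 'Z_p)%type] in
  [/\ isometry_classes (@Gammas h p) #= `I_3,
      isometry_classes (@Gammas h p) = [set A; B; C],
      A #= `I_((p ^ 10 * (p ^ 10 + 1)) %/ 2),
      B #= `I_((p ^ 10 * (p ^ 10 - 1)) %/ 2)
    & C #= `I_((p ^ 20 - 1) %/ (p - 1))].
Proof.
move=> A B C; have p_gt0 := prime_gt0 p_prime.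
have [eta eta_ns] := exists_nonsquare (Fp_2neq0 p_prime p_odd).
have eta0 : eta != 0.
  by apply: contraNneq eta_ns => ->; apply/is_squareP; exists 0; rewrite expr0n.
have [L [LS LT]] := class_typing eta_ns.
have GamS G : Gammas p G <-> exists2 j, (j < 3)%N & class_family eta j G.
  rewrite (Gammas_disc_family G eta_ns); split=> [[]|[[|[|[|//]]] _]].
  - by exists 0.
  - by exists 1.
  - by exists 2.
  - exact: Or31.
  - exact: Or32.
  - exact: Or33.
have typeE j : (j < 3)%N ->
    [set G | Gammas p G /\ class_type j (sublattice G)] = class_family eta j.
  move=> j3; apply/seteqP; split=> G /=.
  - by move=> [/GamS[i i3 SG]] /(LT _ _ _ j3 i3 (LS _ _ i3 SG)) ->.
  - move=> SG; split; first by apply/GamS; exists j.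
    exact/(LT _ _ _ j3 j3 (LS _ _ j3 SG)).
have AE : A = class_family eta 0.
  rewrite -typeE //; apply/seteqP; split=> G [GG [iG [v [k [gv rv sk]]]]];
    split=> //; split=> //; exists v, k; split=> //; exact/square_modP.
have BE : B = class_family eta 1.
  rewrite -typeE //; apply/seteqP; split=> G [GG [iG [v [k [gv rv sk]]]]];
    split=> //; split=> //; exists v, k; split=> //.
    by apply/negbTE/negP => /(square_modP k p_prime).
  by move=> /(square_modP k p_prime); rewrite sk.
have CE : C = class_family eta 2 by rewrite -typeE.
have even_prod : (p ^ 10 * (p ^ 10 + 1) %/ 2 * 2 = p ^ 10 * (p ^ 10 + 1))%N.
  by rewrite divnK // dvdn2 oddM oddD oddX p_odd.
have even_prod' : (p ^ 10 * (p ^ 10 - 1) %/ 2 * 2 = p ^ 10 * (p ^ 10 - 1))%N.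
  by rewrite divnK // dvdn2 oddM oddB ?expn_gt0 ?p_gt0 // oddX p_odd.
have p10 : (1 < p ^ 10)%N by rewrite -(exp1n 10) ltn_exp2r // prime_gt1.
have cA : A #= `I_((p ^ 10 * (p ^ 10 + 1)) %/ 2).
  rewrite AE; apply: (card_disc_family (n := 2)); rewrite ?oner_neq0 //.
    by rewrite -[RHS](card_square_roots (Fp_2neq0 p_prime p_odd) (oner_neq0 _)) expr1n.
  by rewrite even_prod -[X in (_ - X)%N]muln1 -mulnBr addn2 subn1 addn1.
have cB : B #= `I_((p ^ 10 * (p ^ 10 - 1)) %/ 2).
  rewrite BE; apply: (card_disc_family (n := 0)); rewrite //.
    apply/eqP; rewrite cards_eq0; apply/eqP/finset.setP => x; rewrite !inE.
    apply/negbTE/negP => /eqP xE; case/negP: eta_ns.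
    rewrite (_ : eta = x ^+ 2) //; by apply/is_squareP; exists x.
  by rewrite even_prod' mulnBr muln1 addn0.
have cC : C #= `I_((p ^ 20 - 1) %/ (p - 1)).
  by rewrite CE; apply: card_isotropic_family.
have le2 : (2 <= p ^ 10 * (p ^ 10 + 1))%N.
  by rewrite (leq_trans p10) // leq_pmulr // addn1.
have le2' : (2 <= p ^ 10 * (p ^ 10 - 1))%N.
  by rewrite (leq_trans p10) // leq_pmulr // subn_gt0.
have fam0 (j : 'I_3) : class_family eta j !=set0.
  case: j => -[|[|[|//]]] lj /=.
  - by rewrite -AE; apply: card_nonempty cA; rewrite divn_gt0.
  - by rewrite -BE; apply: card_nonempty cB; rewrite divn_gt0.
  - rewrite -CE; apply: card_nonempty cC; have p1 := prime_gt1 p_prime.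
    by rewrite divn_gt0 ?subn_gt0 // leq_sub2r // -{1}(expn1 p) leq_exp2l.
have [|j G|i j iso_ij|//|classE cardE] := @isometry_classes_range _ (@Gammas h p) 3
    (fun j => class_family eta j) (fun j => L j).
- move=> G; rewrite GamS; split=> [[j j3 SG]|[j SG]].
    by exists (Ordinal j3).
  by exists j.
- exact: LS.
- have isoj : isometric (L j) (L j) := isom_isometric (isom_id _).
  apply/val_inj; apply: (proj1 (LT i j _ (ltn_ord i) (ltn_ord j) isoj)).
  exact: (proj2 (LT i i _ (ltn_ord i) (ltn_ord i) iso_ij)).
split=> //; rewrite classE AE BE CE.
by have := range_ord3 (fun j : 'I_3 => class_family eta j); rewrite !inordK.
Qed.
End CoprimeCase.

Section DivisibleCase.
Hypothesis pd : (p %| d)%N.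

(** The functionals with [i = 0] and [lambda ^ 2 = a]; the value [a = - 2 c] of
    interest is normalized below to [- 2], [- 2 eta] and [0]. *)
Definition quad_family (a : 'F_p) : {set coeffs} :=
  finset.setX [set 0]%SET [set x | (x != 0) && (quad x == a)]%SET.

Definition fiber_family : {set coeffs} := finset.setX [set 1]%SET [set: 'rV['F_p]_rk]%SET.

Lemma quad_familyP (a : 'F_p) v : reflect
  [/\ v != (0, 0), v.1 = 0 & quad v.2 = a] (v \in quad_family a).
Proof.
rewrite !inE; apply: (iffP and3P) => [[/eqP v1 v2 /eqP vq]|[v0 v1 vq]].
- by split=> //; apply: contra v2 => /eqP->.
- split; rewrite ?v1 ?vq //; apply: contra v0 => /eqP v2.
  by case: v v1 v2 {vq} => ? ? /= -> ->.
Qed.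

Lemma scale_quad_family c v a : v \in quad_family a -> c != 0 ->
  (scale_coeffs c v \in quad_family a) = (c ^+ 2 * a == a).
Proof.
move=> /quad_familyP[v0 v1 vq] c0; apply/quad_familyP/eqP => [[_ _]|].
  by rewrite quadZ vq.
by split; rewrite ?scale_coeffs_neq0 //= ?v1 ?mulr0 // quadZ vq.
Qed.

Lemma card_quad_family a m : a != 0 -> (m * 2 = p ^ 9 * (p ^ 10 - 1))%N ->
  kernel_family (quad_family a) #= `I_m.
Proof.
move=> a0 mE; apply: (@card_kernel_family _ _ _ _ _ psi_isom phiK _ 2).
- by [].
- by move=> v /quad_familyP[].
- move=> v vX; rewrite -[RHS](card_sign p_prime p_odd a0); apply: eq_card => c.
  by rewrite inE [RHS]inE; apply: andb_id2l => c0; apply: scale_quad_family.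
- rewrite mE -(card_quad_level p_prime p_odd a0) card_slice; apply: eq_card => x.
  rewrite !inE andb_idl // => /eqP xa; apply: contraNneq a0 => x0.
  by rewrite -xa x0 /gram_quad !mul0mx mxE.
Qed.

Lemma card_isotropic_quad_family :
  kernel_family (quad_family 0) #= `I_(((p ^ 9 + 1) * (p ^ 10 - 1)) %/ (p - 1)).
Proof.
have p1 := prime_gt1 p_prime.
apply: (@card_kernel_family _ _ _ _ _ psi_isom phiK _ (p - 1)).
- by rewrite subn_gt0.
- by move=> v /quad_familyP[].
- move=> v vX; have := cardC1 (0 : 'F_p); rewrite card_Fp // subn1 => <-.
  apply: eq_card => c; rewrite !inE; apply/andP/idP => [[]//|c0]; split=> //.
  by have := scale_quad_family vX c0; rewrite !inE mulr0 eqxx.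
- rewrite card_slice divnK; last first.
    by rewrite dvdn_mull // !subn1 -(exp1n 10) dvdn_pred_predX.
  rewrite -(card_quad_isotropic p_prime p_odd); apply: eq_card => x.
  by rewrite !inE.
Qed.

Lemma card_fiber_family : kernel_family fiber_family #= `I_(p ^ 20).
Proof.
apply: (@card_kernel_family _ _ _ _ _ psi_isom phiK _ 1).
- by [].
- by move=> v; rewrite !inE andbT; apply: contraTneq => ->; rewrite eq_sym oner_neq0.
- move=> v; rewrite !inE andbT => /eqP v1.
  rewrite -[RHS](cards1 (1 : 'F_p)); apply: eq_card => c; rewrite !inE /= v1 mulr1 andbT.
  by apply: andb_idl => /eqP->; apply: oner_neq0.
- by rewrite card_slice cardsT card_mx card_Fp // mul1n muln1.
Qed.

Lemma quad_family_split (a : 'F_p) (t : int) G : (2 * t)%:~R = a ->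
  kernel_family (quad_family a) G ->
  isometric (split_lattice E8neg2 d p t) (sublattice G).
Proof.
move=> ta [v /= /quad_familyP[v0 v1 vq]] <-.
apply: (kernel_lattice_split p_prime phi_isom psi_isom phiK p_odd v0 (i := 0)).
  by rewrite mulr0 v1.
by rewrite vq ta expr2 !mulr0 addr0.
Qed.

Lemma fiber_family_twisted G : kernel_family fiber_family G ->
  isometric (twisted_lattice E8neg2 d p) (sublattice G).
Proof.
move=> [v /=]; rewrite !inE andbT => /eqP v1 <-.
exact: (kernel_lattice_twisted p_prime phi_isom psi_isom phiK pd v1).
Qed.

Lemma quad_family_scaled c (a : 'F_p) v : v != (0, 0) -> v.1 = 0 -> c != 0 ->
  quad v.2 = c ^+ 2 * a -> kernel_family (quad_family a) (ker_lat v).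
Proof.
move=> v0 v1 c0 vq; exists (scale_coeffs c^-1 v); last first.
  by rewrite ker_lat_scale // invr_eq0.
apply/quad_familyP; split; first by rewrite scale_coeffs_neq0 ?invr_eq0.
  by rewrite /= v1 mulr0.
by rewrite quadZ vq exprVn mulKf ?sqrf_eq0.
Qed.

(** The lift of [v.2] to [Lambda'] is arbitrary, so [v] knows [c] modulo [p] only. *)
Lemma has_invariants_quad (G : subgroup (T_S h)) (i : nat) (c : int) :
  has_invariants p phi G i c -> exists v, [/\ v != (0, 0), v.1 = i%:R,
    G = ker_lat v & quad v.2 = (- 2 * c)%:~R].
Proof.
move=> /(has_invariants_kernel p psi_isom phiK psiK G i c).
move=> [v [v0 vi GE [l lv lc]]]; exists v; split=> //.
by rewrite mulNr -lc gram_form_intr -lv.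
Qed.

Lemma quad_has_invariants v (i : nat) : v != (0, 0) -> v.1 = i%:R ->
  exists c, has_invariants p phi (ker_lat v) i c /\ quad v.2 = (- 2 * c)%:~R.
Proof.
move=> v0 vi; have [l lv] : exists l : Lambda', map_mx intr l = v.2 := row_lift v.2.
have [k kE] := Lambda'_even l; exists (- k).
have lk : lform l l = - (2 * - k) by rewrite kE; ring.
split; last by rewrite mulNr -lk gram_form_intr -lv.
apply/(has_invariants_kernel p psi_isom phiK psiK _ i (- k)).
by exists v; split=> //; exists l.
Qed.

Lemma Fp_neg2_neq0 : (- 2)%:~R != 0 :> 'F_p.
Proof. by rewrite Fp_intr_eq0 // rpredN dvdz2_odd. Qed.

Definition fiber_class (eta : 'F_p) (j : nat) : set (subgroup (T_S h)) :=
  match j with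
  | 0 => kernel_family (quad_family (- 2)%:~R)
  | 1 => kernel_family (quad_family ((- 2)%:~R * eta))
  | 2 => kernel_family (quad_family 0)
  | _ => kernel_family fiber_family
  end.

Definition fiber_lattice (eta : int) (j : nat) : zlattice :=
  match j with
  | 0 => split_lattice E8neg2 d p (- 1)
  | 1 => split_lattice E8neg2 d p (- eta)
  | 2 => split_lattice E8neg2 d p 0
  | _ => twisted_lattice E8neg2 d p
  end.

Lemma fiber_class_isometric (eta : int) (j : nat) G :
  fiber_class eta%:~R j G -> isometric (fiber_lattice eta j) (sublattice G).
Proof.
case: j => [|[|[|j]]] /=; last exact: fiber_family_twisted.
- by apply: quad_family_split.
- by apply: quad_family_split; rewrite -intrM; congr _%:~R; ring.
- by apply: quad_family_split; rewrite mulr0.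
Qed.

Lemma split_twisted_nonisometric (t : int) :
  ~~ (p %| t)%Z || (t == 0) ->
  ~ isometric (split_lattice E8neg2 d p t) (twisted_lattice E8neg2 d p).
Proof.
move=> tP /isometric_discr iso; have p1 := prime_gt1 p_prime.
have isoN := twisted_discr E8neg2_unimodular d_gt0 (ltnW p1).
apply: (cyclic_exponent d_gt0 p1).
have iso' := group_iso_trans iso isoN.
apply: (group_iso_exponent (group_iso_sym iso')).
case/orP: tP => [pt|/eqP->].
- apply: group_iso_exponent (split_discr_unit E8neg2_unimodular d_gt0 p_prime p_odd pt) _.
  by move=> x; apply: split_exponent2.
- apply: group_iso_exponent
    (split_discr_isotropic E8neg2_unimodular d_gt0 p_prime (erefl 0)) _.
  by move=> x; apply: split_exponent.
Qed.

(** For [i < j] the parameters are never related by [t = m ^ 2 t'] modulo [p];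
    the converse relation may hold with [m = 0], hence the order. *)
Lemma fiber_lattice_inj (eta : int) (i j : nat) :
  ~~ is_square (eta%:~R : 'F_p) -> (i < j < 4)%N ->
  ~ isometric (fiber_lattice eta i) (fiber_lattice eta j).
Proof.
move=> eta_ns.
have one_n : ~~ (p %| (- 1)%R)%Z by rewrite rpredN -Fp_intr_eq0 // oner_eq0.
have eta_n : ~~ (p %| - eta)%Z.
  rewrite rpredN -Fp_intr_eq0 //; apply: contraNneq eta_ns => ->.
  by apply/is_squareP; exists 0; rewrite expr0n.
case: j i => [|[|[|[|j]]]] [|[|[|i]]] ij /=; try by exfalso; move: ij; clear; lia.
- move=> /(split_isometric_square pd p_prime p_odd)[m].
  rewrite -Fp_intr_eq0 // intrB subr_eq0 intrM !intrN rmorphXn mulrN eqr_opp /=.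
  move=> /eqP mE; case/negP: eta_ns; apply/is_squareP; exists (m%:~R^-1).
  have m0 : m%:~R != 0 :> 'F_p.
    apply/eqP => m0; move: mE => /eqP.
    by rewrite m0 expr0n /= mul0r oner_eq0.
  by apply: (mulfI (_ : m%:~R ^+ 2 != 0)); rewrite ?sqrf_eq0 // -mE exprVn mulfV // sqrf_eq0.
- move=> /(split_isometric_square pd p_prime p_odd)[m].
  by rewrite mulr0 subr0; apply/negP.
- move=> /(split_isometric_square pd p_prime p_odd)[m].
  by rewrite mulr0 subr0; apply/negP.
- by apply: split_twisted_nonisometric; rewrite one_n.
- by apply: split_twisted_nonisometric; rewrite eta_n.
- by apply: split_twisted_nonisometric; rewrite eqxx orbT.
Qed.

Lemma Gammas_fiber_class (eta : 'F_p) G : ~~ is_square eta ->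
  Gammas p G <-> exists2 j, (j < 4)%N & fiber_class eta j G.
Proof.
move=> eta_ns; have nz2 := Fp_neg2_neq0.
rewrite (Gammas_kernel p psi_isom phiK psiK); split; last first.
  move=> [[|[|[|[|//]]]] _ [v /= vX <-]]; exists v => //.
  1-3: by case/quad_familyP: vX.
  move: vX; rewrite !inE andbT; apply: contraTneq => ->.
  by rewrite eq_sym oner_neq0.
move=> [v v0 ->].
have [v1|v1] := eqVneq v.1 0; last first.
  exists 3; rewrite //=; exists (scale_coeffs v.1^-1 v); last first.
    by rewrite ker_lat_scale // invr_eq0.
  by rewrite /= !inE andbT /= mulVf.
have [Q0|Q0] := eqVneq (quad v.2) 0.
  by exists 2; rewrite //=; exists v => //; apply/quad_familyP.
pose r := quad v.2 / (- 2)%:~R.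
have rE : quad v.2 = (- 2)%:~R * r by rewrite mulrC divfK.
have r0 : r != 0 by rewrite mulf_neq0 // invr_eq0.
have [/is_squareP[c cE]|rns] := boolP (is_square r).
  exists 0; rewrite //=; apply: (@quad_family_scaled c); rewrite //.
    by rewrite -sqrf_eq0 -cE.
  by rewrite rE cE mulrC.
have [c c0 cE] := nonsquare_div (Fp_2neq0 p_prime p_odd) eta_ns rns.
exists 1; rewrite //=; apply: (@quad_family_scaled c) => //.
by rewrite rE cE; ring.
Qed.

Lemma classification_divisible :
  let A := [set G | exists c : int, [/\ has_invariants p phi G 0 c,
    ~~ (p %| c)%Z & square_mod p c]] in
  let B := [set G | exists c : int, has_invariants p phi G 0 c /\
    ~ square_mod p c] in
  let C := [set G | exists c : int, has_invariants p phi G 0 c /\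
    (p %| c)%Z] in
  let D := [set G | exists c : int, has_invariants p phi G 1 c] in
  let dG (G : subgroup (T_S h)) := discr (sublattice G) in
  [/\ isometry_classes (@Gammas h p) #= `I_4,
      isometry_classes (@Gammas h p) = [set A; B; C; D],
      [/\ forall G, A G -> group_iso (dG G) ('Z_(2 * d) * 'Z_(p ^ 2))%type,
          forall G, B G -> group_iso (dG G) ('Z_(2 * d) * 'Z_(p ^ 2))%type,
          forall G, C G -> group_iso (dG G) ('Z_(2 * d) * 'Z_p * 'Z_p)%type
        & forall G, D G -> group_iso (dG G) 'Z_N]
    & [/\ A #= `I_((p ^ 9 * (p ^ 10 - 1)) %/ 2),
          B #= `I_((p ^ 9 * (p ^ 10 - 1)) %/ 2),
          C #= `I_(((p ^ 9 + 1) * (p ^ 10 - 1)) %/ (p - 1))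
        & D #= `I_(p ^ 20)]].
Proof.
move=> A B C D dG; have p_gt0 := prime_gt0 p_prime; have nz2 := Fp_neg2_neq0.
have [eta' eta_ns'] := exists_nonsquare (Fp_2neq0 p_prime p_odd).
have [eta etaE] := Fp_intr_surj eta'.
have {eta_ns'}eta_ns : ~~ is_square (eta%:~R : 'F_p) by rewrite etaE.
have eta0 : eta%:~R != 0 :> 'F_p.
  by apply: contraNneq eta_ns => ->; apply/is_squareP; exists 0; rewrite expr0n.
pose S := fiber_class eta%:~R; pose L := fiber_lattice eta.
have family_c a G : kernel_family (quad_family a) G ->
    exists c, has_invariants p phi G 0 c /\ c%:~R = a / (- 2)%:~R.
  move=> [v /= /quad_familyP[v0 v1 vq] <-].
  have [c [cG cv]] := quad_has_invariants v0 (v1 : v.1 = 0%:R).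
  by exists c; split; rewrite // -vq cv intrM mulrC mulKf.
have AE : A = S 0.
  apply/seteqP; split=> G /=.
  - move=> [c [/has_invariants_quad[v [v0 v1 -> vq]] pc]].
    move=> /(square_modP c p_prime)/is_squareP[x cx].
    apply: (@quad_family_scaled x) => //.
      by rewrite -sqrf_eq0 -cx Fp_intr_eq0.
    by rewrite vq intrM cx mulrC.
  - move=> /family_c[c [cG]]; rewrite mulfV // => c1; exists c; split=> //.
      by rewrite -Fp_intr_eq0 // c1 oner_neq0.
    by apply/square_modP => //; apply/is_squareP; exists 1; rewrite c1 expr1n.
have BE : B = S 1.
  apply/seteqP; split=> G /=.
  - move=> [c [/has_invariants_quad[v [v0 v1 -> vq]] cns]].
    have {}cns : ~~ is_square (c%:~R : 'F_p).
      by apply/negP => /(square_modP c p_prime).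
    have [x x0 cx] := nonsquare_div (Fp_2neq0 p_prime p_odd) eta_ns cns.
    by apply: (@quad_family_scaled x) => //; rewrite vq intrM cx; ring.
  - move=> /family_c[c [cG]]; rewrite mulrC mulKf // => ce; exists c; split=> //.
    by move=> /(square_modP c p_prime); rewrite ce; apply/negP.
have CE : C = S 2.
  apply/seteqP; split=> G /=.
  - move=> [c [/has_invariants_quad[v [v0 v1 -> vq]]]].
    rewrite -Fp_intr_eq0 // => /eqP c0; exists v => //=; apply/quad_familyP.
    by split=> //; rewrite vq intrM c0 mulr0.
  - move=> /family_c[c [cG]]; rewrite mul0r => ce; exists c; split=> //.
    by rewrite -Fp_intr_eq0 // ce.
have DE : D = S 3.
  apply/seteqP; split=> G /=.
  - move=> [c /has_invariants_quad[v [v0 v1 -> _]]].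
    by exists v => //=; rewrite !inE andbT v1.
  - move=> [v /=]; rewrite !inE andbT => /eqP v1 <-.
    have v0 : v != (0, 0).
      by apply/eqP => v0; move: v1 => /eqP; rewrite v0 eq_sym oner_eq0.
    by have [c [cG _]] := quad_has_invariants v0 (v1 : v.1 = 1%:R); exists c.
have evenN : (p ^ 9 * (p ^ 10 - 1) %/ 2 * 2 = p ^ 9 * (p ^ 10 - 1))%N.
  by rewrite divnK // dvdn2 oddM oddB ?expn_gt0 ?p_gt0 // !oddX p_odd.
have cA : A #= `I_((p ^ 9 * (p ^ 10 - 1)) %/ 2).
  by rewrite AE; apply: card_quad_family.
have cB : B #= `I_((p ^ 9 * (p ^ 10 - 1)) %/ 2).
  by rewrite BE; apply: card_quad_family; rewrite // mulf_neq0.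
have cC : C #= `I_(((p ^ 9 + 1) * (p ^ 10 - 1)) %/ (p - 1)).
  by rewrite CE; apply: card_isotropic_quad_family.
have cD : D #= `I_(p ^ 20) by rewrite DE; apply: card_fiber_family.
have p1 := prime_gt1 p_prime.
have le_p n : (0 < n)%N -> (p - 1 <= p ^ n - 1)%N.
  by move=> n0; rewrite leq_sub2r // -{1}(expn1 p) leq_exp2l.
have p10 : (2 <= p ^ 10 - 1)%N.
  apply: leq_trans (le_p 10 isT).
  by case: p p_prime p_odd => [|[|[|[|]]]].
have fam0 (j : 'I_4) : S j !=set0.
  case: j => -[|[|[|[|//]]]] lj.
  - rewrite -AE; apply: card_nonempty cA; rewrite divn_gt0 //.
    by rewrite (leq_trans p10) // leq_pmull // expn_gt0 p_gt0.
  - rewrite -BE; apply: card_nonempty cB; rewrite divn_gt0 //.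
    by rewrite (leq_trans p10) // leq_pmull // expn_gt0 p_gt0.
  - rewrite -CE; apply: card_nonempty cC; rewrite divn_gt0 ?subn_gt0 //.
    by rewrite (leq_trans (le_p 10 isT)) // leq_pmull // addn1.
  - by rewrite -DE; apply: card_nonempty cD; rewrite expn_gt0 p_gt0.
have [|j G|i j iso_ij|//|classE cardE] := @isometry_classes_range _ (@Gammas h p) 4
    (fun j => S j) (fun j => L j).
- move=> G; rewrite (Gammas_fiber_class G eta_ns); split=> [[j j4 SG]|[j SG]].
    by exists (Ordinal j4).
  by exists j.
- exact: fiber_class_isometric.
- have lt_noniso (a b : 'I_4) : (a < b)%N -> ~ isometric (L a) (L b).
    by move=> ab; apply: (fiber_lattice_inj eta_ns); rewrite ab ltn_ord.
  case: (ltngtP i j) => [/lt_noniso|/lt_noniso|/val_inj//]; case.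
    exact: iso_ij.
  exact: isometric_sym iso_ij.
have isoD j G : S j G -> group_iso (discr (L j)) (dG G).
  by move=> /fiber_class_isometric/isometric_discr.
have unit_discr (t : int) : ~~ (p %| t)%Z ->
    group_iso (discr (split_lattice E8neg2 d p t)) ('Z_(2 * d) * 'Z_(p ^ 2))%type.
  exact: (split_discr_unit E8neg2_unimodular d_gt0 p_prime p_odd).
split=> //.
- rewrite classE AE BE CE DE.
  by have := range_ord4 (fun j : 'I_4 => S j); rewrite !inordK.
- rewrite AE BE CE DE; split=> G /isoD/group_iso_sym iG; apply: group_iso_trans iG _.
  + by apply: unit_discr; rewrite rpredN -Fp_intr_eq0 // oner_eq0.
  + by apply: unit_discr; rewrite rpredN -Fp_intr_eq0.
  + exact: split_discr_isotropic E8neg2_unimodular d_gt0 p_prime (erefl 0).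
  + exact: twisted_discr E8neg2_unimodular d_gt0 p_gt0.
Qed.
End DivisibleCase.
End Classification.

Theorem theorem9 (R : realType) (S : K3 R) (d : nat) (h : H2)
    (d_gt0 : (0 < d)%N)
    (h_sq : lform h h = 2 * d%:Z)
    (NS_h : NS S = [set h *~ k | k in [set: int]])
    (phi : {additive v0Lambda' d -> T_S h}) (phi_iso : is_isometry phi)
    (p : nat) (p_prime : prime p) (p_odd : odd p) :
  let Gamma := @Gammas h p in
  let dG (G : subgroup (T_S h)) := discr (sublattice G) in
  let N := (2 * d * p ^ 2)%N in
  (~~ (p %| d)%N ->
    let A := [set G | Gamma G /\ group_iso (dG G) 'Z_N /\
      exists (v : dG G) (k : int),
        [/\ generates v, represents (- N%:Z) v k & square_mod p k]] in
    let B := [set G | Gamma G /\ group_iso (dG G) 'Z_N /\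
      exists (v : dG G) (k : int),
        [/\ generates v, represents (- N%:Z) v k & ~ square_mod p k]] in
    let C := [set G | Gamma G /\
      group_iso (dG G) ('Z_(2 * d) * 'Z_p * 'Z_p)%type] in
    [/\ isometry_classes Gamma #= `I_3,
        isometry_classes Gamma = [set A; B; C],
        A #= `I_((p ^ 10 * (p ^ 10 + 1)) %/ 2),
        B #= `I_((p ^ 10 * (p ^ 10 - 1)) %/ 2)
      & C #= `I_((p ^ 20 - 1) %/ (p - 1))]) /\
  ((p %| d)%N ->
    let A := [set G | exists c : int, [/\ has_invariants p phi G 0 c,
      ~~ (p %| c)%Z & square_mod p c]] in
    let B := [set G | exists c : int, has_invariants p phi G 0 c /\
      ~ square_mod p c] in
    let C := [set G | exists c : int, has_invariants p phi G 0 c /\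
      (p %| c)%Z] in
    let D := [set G | exists c : int, has_invariants p phi G 1 c] in
    [/\ isometry_classes Gamma #= `I_4,
        isometry_classes Gamma = [set A; B; C; D],
        [/\ forall G, A G -> group_iso (dG G) ('Z_(2 * d) * 'Z_(p ^ 2))%type,
            forall G, B G -> group_iso (dG G) ('Z_(2 * d) * 'Z_(p ^ 2))%type,
            forall G, C G -> group_iso (dG G) ('Z_(2 * d) * 'Z_p * 'Z_p)%type
          & forall G, D G -> group_iso (dG G) 'Z_N]
      & [/\ A #= `I_((p ^ 9 * (p ^ 10 - 1)) %/ 2),
            B #= `I_((p ^ 9 * (p ^ 10 - 1)) %/ 2),
            C #= `I_(((p ^ 9 + 1) * (p ^ 10 - 1)) %/ (p - 1))
          & D #= `I_(p ^ 20)]]).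
Proof.
move=> Gamma dG N.
have phi_isom : isom phi by case: phi_iso => bphi fphi; split=> //; apply: raddfB.
have [psi [psi_isom phiK psiK]] := isom_inv phi_isom.
split=> pd.
- exact: (classification_coprime d_gt0 p_prime p_odd phi_isom psi_isom phiK psiK pd).
- exact: (classification_divisible d_gt0 p_prime p_odd phi_isom psi_isom phiK psiK pd).
Qed.
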